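(* Let $\alpha\ge1$, $0<\theta_0\le2\pi$, and let $\bm{u}=u_\theta\bm{e_\theta}+u_r\bm{e_r}\in C^2(\overline{\Omega_{1,2,\theta_0}})$, with pressure $P$, be a solution of the stationary Euler equations in $\Omega_{1,2,\theta_0}$ with $|u_\theta|>0$ in $\overline{\Omega_{1,2,\theta_0}}$. Suppose that for some constants $c_1,c_2$ $$u_\theta(r,0)=\frac{c_1}{r^\alpha},\qquad u_\theta(r,\theta_0)=\frac{c_2}{r^\alpha},\qquad u_r(r,0)=u_r(r,\theta_0)\qquad(1\le r\le 2),$$ and $u_r(1,\theta)=u_r(2,\theta)=0$ for all $\theta\in[0,\theta_0]$. Then $c_1=c_2=:c\neq0$. Moreover, assume that $$c^{-1}\partial_\theta(r^\alpha u_r)|_{\theta=0}\ge 1-\alpha\ \text{ for all } r\in[1,2]\qquad\text{or}\qquad c^{-1}\partial_\theta(r^\alpha u_r)|_{\theta=\theta_0}\ge1-\alpha\ \text{ for all } r\in[1,2].$$ Then $\bm{u}$ is $(-\alpha)$-homogeneous, $P$ is $(-2\alpha)$-homogeneous up to a constant translation, and, for some constant $C$, $$\bm{u}=\frac{c}{r^\alpha}\bm{e_\theta},\qquad P=-\frac{c^2}{2\alpha\, r^{2\alpha}}+C .$$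
   Context: $(r,\theta)$ are polar coordinates in $\mathbb{R}^2$, $\bm{e_r}=(\cos\theta,\sin\theta)^T$, $\bm{e_\theta}=(-\sin\theta,\cos\theta)^T$, and a planar vector field is written $\bm{u}=u_\theta\bm{e_\theta}+u_r\bm{e_r}$. For $0\le a<b\le\infty$ and $\theta_0\in(0,2\pi]$, $\Omega_{a,b,\theta_0}=\{(r,\theta): a<r<b,\ 0<\theta<\theta_0\}$. Functions and fields on $\overline{\Omega_{1,2,\theta_0}}$ are regarded as functions of $(r,\theta)\in[1,2]\times[0,\theta_0]$, with regularity up to the boundary in these coordinates. The stationary Euler equations in $\Omega$ are $\bm{u}\cdot\nabla\bm{u}=-\nabla P$, $\operatorname{div}\bm{u}=0$ in $\Omega$, with $\bm{u}$ the velocity and $P$ a scalar (pressure) function on $\Omega$; $\bm{u}$ is called a solution if these hold with some pressure $P$. $\bm{u}$ is $(-\alpha)$-homogeneous if $\bm{u}=\frac{v(\theta)}{r^\alpha}\bm{e_\theta}+\frac{f(\theta)}{r^\alpha}\bm{e_r}$ for some functions $v,f$ of $\theta$ only; $P$ is $(-2\alpha)$-homogeneous up to a constant translation if $P-C$ is $r^{-2\alpha}$ times a function of $\theta$ for some constant $C$. *)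

(* Defs.v *)
From Stdlib Require Import Reals.
From Coquelicot Require Import Coquelicot.
Open Scope R_scope.

Definition D1 (g : R * R -> R) (z : R * R) : R :=
  Derive (fun t => g (t, snd z)) (fst z).
Definition D2 (g : R * R -> R) (z : R * R) : R :=
  Derive (fun t => g (fst z, t)) (snd z).

Definition differentiable_at (g : R * R -> R) (z : R * R) : Prop :=
  differentiable_pt (fun x y => g (x, y)) (fst z) (snd z).

(* Fields live in Cartesian coordinates.  Differentiability is recorded because
   [Derive] is total, so the equations alone would not say that the derivatives
   exist. *)
Definition stationary_Euler (Omega : R * R -> Prop)
    (u : R * R -> R * R) (P : R * R -> R) : Prop :=
  let u1 := fun z => fst (u z) in
  let u2 := fun z => snd (u z) in
  forall z, Omega z ->
    differentiable_at u1 z /\ differentiable_at u2 z /\ differentiable_at P z /\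
    u1 z * D1 u1 z + u2 z * D2 u1 z = - D1 P z /\
    u1 z * D1 u2 z + u2 z * D2 u2 z = - D2 P z /\
    D1 u1 z + D2 u2 z = 0.

Definition polar (r theta : R) : R * R := (r * cos theta, r * sin theta).
Definition e_r (theta : R) : R * R := (cos theta, sin theta).
Definition e_theta (theta : R) : R * R := (- sin theta, cos theta).

Definition polar_field (ut ur : R -> R -> R) (r theta : R) : R * R :=
  plus (scal (ut r theta) (e_theta theta)) (scal (ur r theta) (e_r theta)).

Definition Omega (a b theta0 : R) (z : R * R) : Prop :=
  exists r theta, a < r < b /\ 0 < theta < theta0 /\ z = polar r theta.

Definition open_rect (a b c d : R) (z : R * R) : Prop :=
  a < fst z < b /\ c < snd z < d.
Definition closed_rect (a b c d : R) (z : R * R) : Prop :=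
  a <= fst z <= b /\ c <= snd z <= d.

(* C^k on the closed rectangle [a,b] x [c,d]: the partial derivatives of order
   at most k exist in the interior and extend continuously to the closure (g1, g2
   are the extensions).  Values of g outside the closed rectangle play no role,
   so g may be any total function. *)
Fixpoint Ck_closed (k : nat) (a b c d : R) (g : R -> R -> R) : Prop :=
  continuous_on (closed_rect a b c d) (fun z => g (fst z) (snd z)) /\
  match k with
  | O => True
  | S k' => exists g1 g2 : R -> R -> R,
      (forall x y, open_rect a b c d (x, y) ->
         is_derive (fun t => g t y) x (g1 x y) /\
         is_derive (fun t => g x t) y (g2 x y)) /\
      Ck_closed k' a b c d g1 /\ Ck_closed k' a b c d g2
  end.

(* Derivative relative to the segment [a,b]: one-sided at its end points. *)
Definition is_derive_seg (a b : R) (g : R -> R) (x l : R) : Prop :=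
  filterlim (fun t => (g t - g x) / (t - x))
    (within (fun t => a <= t <= b) (locally' x)) (locally l).

Definition homogeneous_field (alpha a b theta0 : R) (ut ur : R -> R -> R) : Prop :=
  exists v f : R -> R, forall r theta, closed_rect a b 0 theta0 (r, theta) ->
    polar_field ut ur r theta =
    plus (scal (v theta / Rpower r alpha) (e_theta theta))
         (scal (f theta / Rpower r alpha) (e_r theta)).

Definition homogeneous_pressure_upto_const
    (alpha a b theta0 : R) (P : R * R -> R) : Prop :=
  exists (C : R) (q : R -> R), forall r theta, open_rect a b 0 theta0 (r, theta) ->
    P (polar r theta) - C = Rpower r (- (2 * alpha)) * q theta.

(* Main.v *)
Require Import Defs.
From Stdlib Require Import Reals Lra.
From Coquelicot Require Import Coquelicot.
Open Scope R_scope.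

(** Write V, U for the angular and radial velocities, subscripts for partial
    derivatives in (r, theta), and
      w = (V + r V_r - U_theta) / r
    for the vorticity.  In polar coordinates the Euler equations give the
    divergence equation r U_r + U + V_theta = 0 and, by equality of the mixed
    partials of the pressure, the transport equation r U w_r + V w_theta = 0
    ([Euler_polar], [Z_transport]).

    If Q is transported by the flow then (r U Q)_r + (V Q)_theta = 0; since U
    vanishes on the walls, the integral of V Q over a <= r <= b does not depend
    on theta ([transported_flux]).  Three choices of Q are used.
    - Q = 1 gives c1 = c2.
    - Q = max(0, k w)^2, with k of the sign of V, shows that k w <= 0 everywhere
      as soon as this holds on one of the two rays theta = 0, theta = theta0
      ([vorticity_sign]).  The hypothesis on the derivative of r^alpha u_r is
      exactly this sign condition on one of the rays.
    - The stream function psi is transported, takes the same values on both rays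
      and is strictly monotone in r.  Taking Q = w times a bump function of psi
      shows that w(r,0) = w(r,theta0) ([vorticity_per]).  Together with the
      divergence equation this makes all first derivatives of U and V agree on
      the two rays.

    Let s = U / V, the slope of the stream lines in the coordinates (log r, theta).
    The equations for U and V combine into
      (r V^2 s s_theta)_theta + (r^3 V^2 s s_r)_r
        = r V^2 (s_theta^2 + r^2 s_r^2) - 2 r^2 w V s^2,
    whose right-hand side is nonnegative when w V <= 0.  The left-hand side has
    integral zero, because s = 0 on the walls and everything agrees on the two
    rays; hence s_r = 0, so s = 0 and U = 0 ([no_radial_velocity]).  Then V does
    not depend on theta, and integrating the pressure gradient gives P.

    Functions on the closed rectangle are extended to the plane by clamping both
    coordinates.  The extension is continuous everywhere and keeps its derivatives
    in the interior; one-sided and tangential derivatives on the boundary are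
    recovered from the continuous extensions of the interior ones
    ([is_derive_snd_closed], [is_derive_seg_unique]). *)

(** * Functions that are C^1 up to the boundary of a rectangle *)

(** Joint continuity on the whole plane. *)
Definition cont2 (f : R -> R -> R) : Prop := forall x y, continuity_2d_pt f x y.

(** [g] is C^1 on the closed rectangle [a,b] x [c,d]: [g1], [g2] are its partial
    derivatives in the interior, and all three functions are continuous.
    Continuity is asked on the whole plane, which clamped functions satisfy. *)
Definition is_C1 (a b c d : R) (g g1 g2 : R -> R -> R) : Prop :=
  cont2 g /\ cont2 g1 /\ cont2 g2 /\
  forall x y, a < x < b -> c < y < d ->
    is_derive (fun t => g t y) x (g1 x y) /\
    is_derive (fun t => g x t) y (g2 x y).

Lemma cont2_fst f y x : cont2 f -> continuity_pt (fun t => f t y) x.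
Proof.
intros hf; apply continuity_pt_filterlim, filterlim_locally; intros eps.
destruct (hf x y eps) as [del hdel]; exists del; intros t ht.
apply hdel; [exact ht|].
rewrite Rminus_eq_0, Rabs_R0; apply cond_pos.
Qed.

Lemma cont2_snd f x y : cont2 f -> continuity_pt (fun t => f x t) y.
Proof.
intros hf; apply continuity_pt_filterlim, filterlim_locally; intros eps.
destruct (hf x y eps) as [del hdel]; exists del; intros t ht.
apply hdel; [|exact ht].
rewrite Rminus_eq_0, Rabs_R0; apply cond_pos.
Qed.

Lemma cont2_swap f : cont2 f -> cont2 (fun x y => f y x).
Proof.
intros hf x y eps; destruct (hf y x eps) as [del hdel]; exists del; auto.
Qed.

Lemma C1_swap a b c d g g1 g2 : is_C1 a b c d g g1 g2 ->
  is_C1 c d a b (fun x y => g y x) (fun x y => g2 y x) (fun x y => g1 y x).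
Proof.
intros (h & h1 & h2 & hd); split; [|split; [|split]]; try now apply cont2_swap.
intros x y hx hy; destruct (hd y x hy hx); split; assumption.
Qed.

Lemma cont2_comp h f : continuity h -> cont2 f -> cont2 (fun x y => h (f x y)).
Proof. intros hh hf x y; apply continuity_1d_2d_pt_comp; [apply hh|apply hf]. Qed.

Lemma cont2_const k : cont2 (fun _ _ => k).
Proof. intros x y; apply continuity_2d_pt_const. Qed.

Lemma cont2_plus f g : cont2 f -> cont2 g -> cont2 (fun x y => f x y + g x y).
Proof. intros hf hg x y; now apply continuity_2d_pt_plus. Qed.

Lemma cont2_minus f g : cont2 f -> cont2 g -> cont2 (fun x y => f x y - g x y).
Proof. intros hf hg x y; now apply continuity_2d_pt_minus. Qed.

Lemma cont2_opp f : cont2 f -> cont2 (fun x y => - f x y).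
Proof. intros hf x y; now apply continuity_2d_pt_opp. Qed.

Lemma cont2_mult f g : cont2 f -> cont2 g -> cont2 (fun x y => f x y * g x y).
Proof. intros hf hg x y; now apply continuity_2d_pt_mult. Qed.

Lemma cont2_div f g : cont2 f -> cont2 g -> (forall x y, g x y <> 0) ->
  cont2 (fun x y => f x y / g x y).
Proof.
intros hf hg h0 x y; apply continuity_2d_pt_mult; [apply hf|].
now apply continuity_2d_pt_inv.
Qed.

Lemma C1_const a b c d k : is_C1 a b c d (fun _ _ => k) (fun _ _ => 0) (fun _ _ => 0).
Proof.
split; [|split; [|split]]; try apply cont2_const.
intros x y _ _; split; apply @is_derive_const.
Qed.

Lemma C1_plus a b c d f f1 f2 g g1 g2 : is_C1 a b c d f f1 f2 -> is_C1 a b c d g g1 g2 ->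
  is_C1 a b c d (fun x y => f x y + g x y) (fun x y => f1 x y + g1 x y)
    (fun x y => f2 x y + g2 x y).
Proof.
intros (hf & hf1 & hf2 & hf') (hg & hg1 & hg2 & hg').
split; [|split; [|split]]; try now apply cont2_plus.
intros x y hx hy; destruct (hf' x y hx hy), (hg' x y hx hy).
split; now apply @is_derive_plus.
Qed.

Lemma C1_minus a b c d f f1 f2 g g1 g2 : is_C1 a b c d f f1 f2 -> is_C1 a b c d g g1 g2 ->
  is_C1 a b c d (fun x y => f x y - g x y) (fun x y => f1 x y - g1 x y)
    (fun x y => f2 x y - g2 x y).
Proof.
intros (hf & hf1 & hf2 & hf') (hg & hg1 & hg2 & hg').
split; [|split; [|split]]; try now apply cont2_minus.
intros x y hx hy; destruct (hf' x y hx hy), (hg' x y hx hy).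
split; now apply @is_derive_minus.
Qed.

Lemma C1_mult a b c d f f1 f2 g g1 g2 : is_C1 a b c d f f1 f2 -> is_C1 a b c d g g1 g2 ->
  is_C1 a b c d (fun x y => f x y * g x y) (fun x y => f1 x y * g x y + f x y * g1 x y)
    (fun x y => f2 x y * g x y + f x y * g2 x y).
Proof.
intros (hf & hf1 & hf2 & hf') (hg & hg1 & hg2 & hg').
split; [|split; [|split]]; try (apply cont2_plus); try now apply cont2_mult.
intros x y hx hy; destruct (hf' x y hx hy), (hg' x y hx hy).
split.
- apply (is_derive_mult (fun t => f t y) (fun t => g t y)); try assumption.
  intros; apply Rmult_comm.
- apply (is_derive_mult (fun t => f x t) (fun t => g x t)); try assumption.
  intros; apply Rmult_comm.
Qed.

Lemma C1_comp a b c d h h' f f1 f2 : (forall x, is_derive h x (h' x)) ->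
  continuity h' -> is_C1 a b c d f f1 f2 ->
  is_C1 a b c d (fun x y => h (f x y)) (fun x y => f1 x y * h' (f x y))
    (fun x y => f2 x y * h' (f x y)).
Proof.
intros hh hh' (hf & hf1 & hf2 & hf').
assert (ch : continuity h).
{ intros x; apply continuity_pt_filterlim.
  apply (ex_derive_continuous h); now exists (h' x). }
split; [|split; [|split]].
- now apply cont2_comp.
- apply cont2_mult; [assumption|now apply cont2_comp].
- apply cont2_mult; [assumption|now apply cont2_comp].
- intros x y hx hy; destruct (hf' x y hx hy).
  split.
  + apply (is_derive_comp h (fun t => f t y)); [apply hh|assumption].
  + apply (is_derive_comp h (fun t => f x t)); [apply hh|assumption].
Qed.

Lemma C1_div a b c d f f1 f2 g g1 g2 : is_C1 a b c d f f1 f2 -> is_C1 a b c d g g1 g2 ->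
  (forall x y, g x y <> 0) ->
  is_C1 a b c d (fun x y => f x y / g x y)
    (fun x y => (f1 x y * g x y - f x y * g1 x y) / (g x y * g x y))
    (fun x y => (f2 x y * g x y - f x y * g2 x y) / (g x y * g x y)).
Proof.
intros (hf & hf1 & hf2 & hf') (hg & hg1 & hg2 & hg') h0.
assert (h00 : forall x y, g x y * g x y <> 0).
{ intros x y; apply Rmult_integral_contrapositive; auto. }
split; [now apply cont2_div|split; [|split]].
1, 2: apply cont2_div; [apply cont2_minus| |assumption]; now apply cont2_mult.
intros x y hx hy; destruct (hf' x y hx hy), (hg' x y hx hy).
split.
- replace (g x y * g x y) with (g x y ^ 2) by ring.
  apply (is_derive_div (fun t => f t y) (fun t => g t y)); auto.
- replace (g x y * g x y) with (g x y ^ 2) by ring.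
  apply (is_derive_div (fun t => f x t) (fun t => g x t)); auto.
Qed.

(** Projection of the line onto [a,b]. *)
Definition clamp (a b x : R) : R := Rmax a (Rmin b x).

Lemma clamp_in a b x : a <= b -> a <= clamp a b x <= b.
Proof.
intros h; unfold clamp, Rmax, Rmin; repeat destruct Rle_dec; lra.
Qed.

Lemma clamp_id a b x : a <= x <= b -> clamp a b x = x.
Proof.
intros h; unfold clamp, Rmax, Rmin; repeat destruct Rle_dec; lra.
Qed.

Lemma clamp_lip a b x y : Rabs (clamp a b x - clamp a b y) <= Rabs (x - y).
Proof.
unfold clamp, Rmax, Rmin, Rabs; repeat destruct Rle_dec; repeat destruct Rcase_abs; lra.
Qed.

Lemma cont2_clamp a b c d g : a <= b -> c <= d ->
  continuous_on (closed_rect a b c d) (fun z => g (fst z) (snd z)) ->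
  cont2 (fun x y => g (clamp a b x) (clamp c d y)).
Proof.
intros hab hcd hg x y eps.
assert (hz : closed_rect a b c d (clamp a b x, clamp c d y)).
{ split; apply clamp_in; assumption. }
destruct (proj1 (filterlim_locally _ _) (hg _ hz) eps) as [del hdel].
exists del; intros u v hu hv.
apply (hdel (clamp a b u, clamp c d v)).
- split; apply Rle_lt_trans with (1 := clamp_lip _ _ _ _); assumption.
- split; apply clamp_in; assumption.
Qed.

Lemma C1_clamp a b c d g g1 g2 : a <= b -> c <= d ->
  continuous_on (closed_rect a b c d) (fun z => g (fst z) (snd z)) ->
  continuous_on (closed_rect a b c d) (fun z => g1 (fst z) (snd z)) ->
  continuous_on (closed_rect a b c d) (fun z => g2 (fst z) (snd z)) ->
  (forall x y, open_rect a b c d (x, y) ->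
     is_derive (fun t => g t y) x (g1 x y) /\ is_derive (fun t => g x t) y (g2 x y)) ->
  is_C1 a b c d (fun x y => g (clamp a b x) (clamp c d y))
    (fun x y => g1 (clamp a b x) (clamp c d y))
    (fun x y => g2 (clamp a b x) (clamp c d y)).
Proof.
intros hab hcd hg hg1 hg2 hd.
split; [|split; [|split]]; try now apply cont2_clamp.
intros x y hx hy; destruct (hd x y (conj hx hy)) as [d1 d2].
rewrite (clamp_id a b x), (clamp_id c d y) by lra.
split.
- apply is_derive_ext_loc with (2 := d1).
  apply (filter_imp (fun t => a < t < b)).
  + intros t ht; rewrite clamp_id; lra.
  + apply filter_and; [apply open_gt|apply open_lt]; lra.
- apply is_derive_ext_loc with (2 := d2).
  apply (filter_imp (fun t => c < t < d)).
  + intros t ht; rewrite (clamp_id c d t); lra.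
  + apply filter_and; [apply open_gt|apply open_lt]; lra.
Qed.

Lemma C1_clamp_fst a b c d : a <= b ->
  is_C1 a b c d (fun x _ => clamp a b x) (fun _ _ => 1) (fun _ _ => 0).
Proof.
intros hab; split; [|split; [|split]]; try apply cont2_const.
- intros x y eps; exists eps; intros u v hu _.
  apply Rle_lt_trans with (1 := clamp_lip _ _ _ _); assumption.
- intros x y hx hy; split; [|apply @is_derive_const].
  apply (is_derive_ext_loc (fun t => t)); [|apply @is_derive_id].
  apply (filter_imp (fun t => a < t < b)).
  + intros t ht; rewrite clamp_id; lra.
  + apply filter_and; [apply open_gt|apply open_lt]; lra.
Qed.

Lemma le0_closed F a b x del : a < b -> a <= x <= b -> 0 < del -> continuity_pt F x ->
  (forall u, a < u < b -> Rabs (u - x) < del -> F u <= 0) -> F x <= 0.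
Proof.
intros hab hx hdel hF h.
destruct (Rle_lt_dec (F x) 0) as [|hpos]; [assumption|exfalso].
apply continuity_pt_filterlim in hF.
destruct (proj1 (filterlim_locally _ _) hF (mkposreal _ hpos)) as [e he].
set (m := Rmin (Rmin (e / 2) (del / 2)) ((b - a) / 4)).
assert (hm : 0 < m /\ m < e /\ m < del /\ m <= (b - a) / 4).
{ assert (he0 := cond_pos e).
  unfold m, Rmin; repeat destruct Rle_dec; lra. }
assert (hu : exists u, a < u < b /\ Rabs (u - x) = m).
{ destruct (Rle_lt_dec x ((a + b) / 2)).
  - exists (x + m); split; [lra|]; replace (x + m - x) with m by ring.
    apply Rabs_pos_eq; lra.
  - exists (x - m); split; [lra|]; replace (x - m - x) with (- m) by ring.
    rewrite Rabs_Ropp; apply Rabs_pos_eq; lra. }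
destruct hu as (u & hu & hux).
assert (h1 : Rabs (F u - F x) < F x).
{ apply he; change (Rabs (u - x) < e); lra. }
assert (h2 := h u hu ltac:(lra)).
apply Rabs_def2 in h1; lra.
Qed.

(** Mean value inequality in the second variable, valid also on the sides
    [x = a] and [x = b], where [g] is reached as a limit from the interior. *)
Lemma mean_value_closed a b c d g g1 g2 x y y' L eps del :
  is_C1 a b c d g g1 g2 -> a < b -> a <= x <= b -> c <= y <= d -> c <= y' <= d ->
  0 < del ->
  (forall u v, Rabs (u - x) < del -> Rmin y y' <= v <= Rmax y y' ->
     Rabs (g2 u v - L) <= eps) ->
  Rabs (g x y' - g x y - L * (y' - y)) <= eps * Rabs (y' - y).
Proof.
intros (hg & _ & _ & hd) hab hx hy hy' hdel h.
apply Rminus_le.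
apply (le0_closed (fun u => Rabs (g u y' - g u y - L * (y' - y)) - eps * Rabs (y' - y))
  a b x del); try assumption.
- apply continuity_pt_minus; [|now apply continuity_pt_const; intros ? ?].
  apply (continuity_pt_comp (fun u => g u y' - g u y - L * (y' - y)) Rabs);
    [|apply Rcontinuity_abs].
  apply continuity_pt_minus; [|now apply continuity_pt_const; intros ? ?].
  apply continuity_pt_minus; now apply cont2_fst.
- intros u hu hux.
  destruct (MVT_gen (fun t => g u t) y y' (fun t => g2 u t)) as (xi & hxi & e).
  + intros t ht; apply (hd u t hu).
    revert ht; unfold Rmin, Rmax; repeat destruct Rle_dec; lra.
  + intros t _; now apply cont2_snd.
  + simpl in e; rewrite e, <- Rmult_minus_distr_r, Rabs_mult.
    apply Rle_minus, Rmult_le_compat_r; [apply Rabs_pos|].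
    now apply h.
Qed.

(** On the sides [x = a] and [x = b] the tangential derivative exists and is the
    continuous extension of the interior one. *)
Lemma is_derive_snd_closed a b c d g g1 g2 x y : a < b ->
  is_C1 a b c d g g1 g2 -> a <= x <= b -> c < y < d ->
  is_derive (fun t => g x t) y (g2 x y).
Proof.
intros hab hC hx hy; apply is_derive_Reals.
intros eps heps.
assert (h2 : cont2 g2) by apply hC.
destruct (h2 x y (mkposreal (eps / 2) ltac:(lra))) as [del hdel].
assert (hdel0 := cond_pos del).
set (m := Rmin del (Rmin (y - c) (d - y))).
assert (hm : 0 < m /\ m <= del /\ m <= y - c /\ m <= d - y).
{ unfold m, Rmin; repeat destruct Rle_dec; lra. }
exists (mkposreal m (proj1 hm)); intros t ht0 ht; simpl in ht.
assert (ht' := Rabs_def2 _ _ ht).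
assert (hmv : Rabs (g x (y + t) - g x y - g2 x y * (y + t - y)) <=
  eps / 2 * Rabs (y + t - y)).
{ apply (mean_value_closed a b c d g g1 g2 x y (y + t) (g2 x y) (eps / 2) del);
    try assumption; try lra.
  intros u v hu hv; left; apply (hdel u v); [assumption|].
  revert hv; unfold Rmin, Rmax; destruct Rle_dec; intros hv; apply Rabs_def1; lra. }
replace (y + t - y) with t in hmv by ring.
replace ((g x (y + t) - g x y) / t - g2 x y) with
  ((g x (y + t) - g x y - g2 x y * t) / t) by (field; assumption).
unfold Rdiv; rewrite Rabs_mult, Rabs_inv.
apply Rle_lt_trans with (eps / 2); [|lra].
assert (ht1 := Rabs_pos_lt _ ht0).
apply Rmult_le_reg_r with (Rabs t); [assumption|].
rewrite Rmult_assoc, Rinv_l, Rmult_1_r by lra; assumption.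
Qed.

Lemma is_derive_fst_closed a b c d g g1 g2 x y : c < d ->
  is_C1 a b c d g g1 g2 -> a < x < b -> c <= y <= d ->
  is_derive (fun t => g t y) x (g1 x y).
Proof.
intros hcd hC hx hy.
exact (is_derive_snd_closed c d a b _ _ _ y x hcd (C1_swap _ _ _ _ _ _ _ hC) hy hx).
Qed.

(** The normal derivative at the boundary, taken one-sidedly, is the continuous
    extension of the interior one. *)
Lemma is_derive_seg_unique a b c d g g1 g2 x y l : a < b -> c < d ->
  is_C1 a b c d g g1 g2 -> a <= x <= b -> c <= y <= d ->
  is_derive_seg c d (fun t => g x t) y l -> l = g2 x y.
Proof.
intros hab hcd hC hx hy hl.
destruct (Req_dec l (g2 x y)) as [|hne]; [assumption|exfalso].
assert (hpos : 0 < Rabs (l - g2 x y)) by (apply Rabs_pos_lt; lra).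
set (eps := mkposreal (Rabs (l - g2 x y) / 3) ltac:(lra)).
assert (h2 : cont2 g2) by apply hC.
destruct (h2 x y eps) as [del hdel].
destruct (proj1 (filterlim_locally _ _) hl eps) as [e he].
assert (hdel0 := cond_pos del). assert (he0 := cond_pos e).
set (m := Rmin (Rmin (e / 2) (del / 2)) ((d - c) / 4)).
assert (hm : 0 < m /\ m < e /\ m < del /\ m <= (d - c) / 4).
{ unfold m, Rmin; repeat destruct Rle_dec; lra. }
assert (hu : exists t, c <= t <= d /\ Rabs (t - y) = m).
{ destruct (Rle_lt_dec y ((c + d) / 2)).
  - exists (y + m); split; [lra|]; replace (y + m - y) with m by ring.
    apply Rabs_pos_eq; lra.
  - exists (y - m); split; [lra|]; replace (y - m - y) with (- m) by ring.
    rewrite Rabs_Ropp; apply Rabs_pos_eq; lra. }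
destruct hu as (t & ht & hty).
assert (hty0 : t <> y).
{ intros ->; rewrite Rminus_eq_0, Rabs_R0 in hty; lra. }
assert (q1 : Rabs ((g x t - g x y) / (t - y) - l) < eps).
{ apply he; try assumption; change (Rabs (t - y) < e); lra. }
assert (hmv : Rabs (g x t - g x y - g2 x y * (t - y)) <= eps * Rabs (t - y)).
{ apply (mean_value_closed a b c d g g1 g2 x y t (g2 x y) eps del);
    try assumption.
  intros u v hu hv; left; apply (hdel u v); [assumption|].
  apply Rle_lt_trans with (Rabs (t - y)); [|lra].
  revert hv; unfold Rmin, Rmax, Rabs; repeat destruct Rle_dec; repeat destruct Rcase_abs; lra. }
assert (q2 : Rabs ((g x t - g x y) / (t - y) - g2 x y) <= eps).
{ replace ((g x t - g x y) / (t - y) - g2 x y) with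
    ((g x t - g x y - g2 x y * (t - y)) / (t - y)) by (field; lra).
  unfold Rdiv; rewrite Rabs_mult, Rabs_inv.
  apply Rmult_le_reg_r with (Rabs (t - y)); [lra|].
  rewrite Rmult_assoc, Rinv_l, Rmult_1_r by lra; assumption. }
set (q := (g x t - g x y) / (t - y)) in *.
unfold eps in q1, q2; simpl in q1, q2.
assert (h3 := Rabs_triang (l - q) (q - g2 x y)).
replace (l - q + (q - g2 x y)) with (l - g2 x y) in h3 by ring.
rewrite (Rabs_minus_sym l q) in h3; lra.
Qed.

(** * One-dimensional integrals *)

Lemma derive_zero_const f a b : a <= b -> (forall x, continuity_pt f x) ->
  (forall x, a < x < b -> is_derive f x 0) -> f b = f a.
Proof.
intros hab hc hd.
destruct (MVT_gen f a b (fun _ => 0)) as (x & _ & e).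
- rewrite Rmin_left, Rmax_right by assumption; assumption.
- intros; apply hc.
- simpl in e; lra.
Qed.

Lemma ex_RInt_cont f a b : continuity f -> ex_RInt f a b.
Proof.
intros hf; apply (ex_RInt_continuous (V := R_CompleteNormedModule)); intros z _.
apply continuity_pt_filterlim, hf.
Qed.

Lemma is_derive_primitive f a x : continuity f -> is_derive (fun t => RInt f a t) x (f x).
Proof.
intros hf; apply (is_derive_RInt f (fun t => RInt f a t) a).
- apply filter_forall; intros t.
  apply (RInt_correct (V := R_CompleteNormedModule)).
  now apply ex_RInt_cont.
- apply continuity_pt_filterlim, hf.
Qed.

(** Fundamental theorem of calculus with no differentiability at the end points. *)
Lemma RInt_derive_open f f' a b : a <= b -> continuity f -> continuity f' ->
  (forall x, a < x < b -> is_derive f x (f' x)) -> RInt f' a b = f b - f a.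
Proof.
intros hab hf hf' hd.
assert (e : RInt f' a b - f b = RInt f' a a - f a).
{ apply (derive_zero_const (fun x => RInt f' a x - f x) a b hab).
  - intros x; apply continuity_pt_minus; [|apply hf].
    apply continuity_pt_filterlim.
    apply (ex_derive_continuous (fun t => RInt f' a t)); exists (f' x).
    now apply is_derive_primitive.
  - intros x hx; replace 0 with (f' x - f' x) by ring.
    apply @is_derive_minus; [now apply is_derive_primitive|now apply hd]. }
rewrite RInt_point in e; change (@zero R_CompleteNormedModule) with 0 in e; lra.
Qed.

Lemma RInt_eq0 (f : R -> R) a b : a <= b -> (forall x, a < x < b -> f x = 0) ->
  RInt f a b = 0.
Proof.
intros hab h; rewrite (RInt_ext f (fun _ => 0)).
- rewrite RInt_const; apply Rmult_0_r.
- intros x; rewrite Rmin_left, Rmax_right by assumption; apply h.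
Qed.

Lemma RInt_nonneg_eq0 f a b : a < b -> continuity f ->
  (forall x, a < x < b -> 0 <= f x) -> RInt f a b = 0 ->
  forall x, a < x < b -> f x = 0.
Proof.
intros hab hf h0 hI.
assert (hz : forall t, a <= t <= b -> RInt f a t = 0).
{ intros t ht.
  assert (h1 : 0 <= RInt f a t).
  { apply RInt_ge_0; [lra|now apply ex_RInt_cont|]; intros; apply h0; lra. }
  assert (h2 : 0 <= RInt f t b).
  { apply RInt_ge_0; [lra|now apply ex_RInt_cont|]; intros; apply h0; lra. }
  assert (h3 := RInt_Chasles (V := R_CompleteNormedModule) f a t b
     (ex_RInt_cont f a t hf) (ex_RInt_cont f t b hf)).
  change plus with Rplus in h3; lra. }
intros x hx.
assert (d1 := is_derive_unique _ _ _ (is_derive_primitive f a x hf)).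
rewrite <- d1; transitivity (Derive (fun _ => 0) x); [|apply Derive_const].
apply Derive_ext_loc.
apply (filter_imp (fun t => a < t < b)).
- intros t ht; apply hz; lra.
- apply filter_and; [apply open_gt|apply open_lt]; lra.
Qed.

Lemma cont2_RInt f a : cont2 f -> cont2 (fun x y => RInt (fun t => f t y) a x).
Proof.
intros hf x y eps.
assert (cf : forall v, continuity (fun t => f t v)).
{ intros v t; now apply cont2_fst. }
set (m := Rmin a x - 1). set (M := Rmax a x + 1).
assert (hmM : m <= a - 1 /\ m <= x - 1 /\ a + 1 <= M /\ x + 1 <= M).
{ unfold m, M, Rmin, Rmax; destruct Rle_dec; lra. }
assert (heps := cond_pos eps).
assert (heta : 0 < eps / (2 * (M - m))) by (apply Rdiv_lt_0_compat; lra).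
destruct (uniform_continuity_2d_1d f m M y (fun u _ => hf u y) (mkposreal _ heta))
  as [d1 h1].
assert (hd : continuity_pt (fun t => RInt (fun t => f t y) a t) x).
{ apply continuity_pt_filterlim.
  apply (ex_derive_continuous (fun t => RInt (fun s => f s y) a t)); eexists.
  now apply (is_derive_primitive (fun s => f s y)). }
apply continuity_pt_filterlim in hd.
destruct (proj1 (filterlim_locally _ _) hd (mkposreal (eps / 2) ltac:(lra))) as [d2 h2].
assert (hd1 := cond_pos d1). assert (hd2 := cond_pos d2).
assert (hpos : 0 < Rmin 1 (Rmin d1 d2)).
{ unfold Rmin; repeat destruct Rle_dec; lra. }
exists (mkposreal _ hpos); simpl; intros u v hu hv.
assert (hu1 : Rabs (u - x) < 1 /\ Rabs (u - x) < d2 /\ Rabs (v - y) < d1).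
{ revert hu hv; unfold Rmin; repeat destruct Rle_dec; lra. }
destruct hu1 as (hu1 & hu2 & hv1).
apply Rabs_def2 in hu1; apply Rabs_def2 in hv1.
replace (RInt (fun t => f t v) a u - RInt (fun t => f t y) a x) with
  (RInt (fun t => f t v - f t y) a u +
   (RInt (fun t => f t y) a u - RInt (fun t => f t y) a x)).
2: { rewrite (RInt_minus (V := R_CompleteNormedModule) (fun t => f t v) (fun t => f t y));
     try now apply ex_RInt_cont.
     unfold minus, plus, opp; simpl; ring. }
assert (hdiff : forall t, m <= t <= M -> Rabs (f t v - f t y) <= eps / (2 * (M - m))).
{ intros t ht; left; apply (h1 t y t v); try lra.
  rewrite Rminus_eq_0, Rabs_R0; assumption. }
assert (hcd : continuity (fun t => f t v - f t y)).
{ intros t; apply continuity_pt_minus; apply cf. }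
assert (b1 : forall p q, m <= p -> p <= q -> q <= M ->
   Rabs (RInt (fun t => f t v - f t y) p q) <= eps / 2).
{ intros p q hp hpq hq; eapply Rle_trans.
  - apply (abs_RInt_le_const _ p q (eps / (2 * (M - m)))); [assumption|now apply ex_RInt_cont|].
    intros t ht; apply hdiff; lra.
  - apply Rle_trans with ((M - m) * (eps / (2 * (M - m)))).
    + apply Rmult_le_compat_r; lra.
    + right; field; lra. }
assert (b2 : Rabs (RInt (fun t => f t v - f t y) a u) <= eps / 2).
{ destruct (Rle_lt_dec a u).
  - apply b1; lra.
  - rewrite <- (opp_RInt_swap (V := R_CompleteNormedModule) (fun t => f t v - f t y))
      by now apply ex_RInt_cont.
    change opp with Ropp; rewrite Rabs_Ropp; apply b1; lra. }
assert (b3 : Rabs (RInt (fun t => f t y) a u - RInt (fun t => f t y) a x) < eps / 2).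
{ exact (h2 u hu2). }
eapply Rle_lt_trans; [apply Rabs_triang|lra].
Qed.

(** * The divergence theorem on slices, and mixed partials *)

Lemma locally_between a b x : a < x < b -> locally x (fun t => a < t < b).
Proof. intros h; apply filter_and; [apply open_gt|apply open_lt]; lra. Qed.

Lemma locally_2d_between a b c d x y : a < x < b -> c < y < d ->
  locally_2d (fun u v => a < u < b /\ c < v < d) x y.
Proof.
intros hx hy.
destruct (locally_between a b x hx) as [e1 h1], (locally_between c d y hy) as [e2 h2].
assert (h : 0 < Rmin e1 e2) by (apply Rmin_pos; apply cond_pos).
exists (mkposreal _ h); simpl; intros u v hu hv; split.
- apply h1; apply Rlt_le_trans with (1 := hu), Rmin_l.
- apply h2; apply Rlt_le_trans with (1 := hv), Rmin_r.
Qed.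

Lemma is_derive_RInt_strip a b c d g g1 g2 p q y : a < b ->
  is_C1 a b c d g g1 g2 -> a <= p -> p <= q -> q <= b -> c < y < d ->
  is_derive (fun v => RInt (fun x => g x v) p q) y (RInt (fun x => g2 x y) p q).
Proof.
intros hab hC hp hpq hq hy.
assert (hg : cont2 g) by apply hC.
assert (hg2 : cont2 g2) by apply hC.
assert (hd : forall v t, c < v < d ->
  is_derive (fun u => g (clamp p q t) u) v (g2 (clamp p q t) v)).
{ intros v t hv; apply (is_derive_snd_closed a b c d g g1 g2); try assumption.
  assert (h := clamp_in p q t hpq); lra. }
assert (hc2 : cont2 (fun v t => g2 (clamp p q t) v)).
{ intros v t eps; destruct (hg2 (clamp p q t) v eps) as [del hdel].
  exists del; intros v' t' hv ht; apply hdel; [|assumption].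
  apply Rle_lt_trans with (1 := clamp_lip _ _ _ _); assumption. }
assert (e : RInt (fun x => g2 x y) p q =
   RInt (fun t => Derive (fun u => g (clamp p q t) u) y) p q).
{ apply RInt_ext; intros t; rewrite Rmin_left, Rmax_right by assumption; intros ht.
  transitivity (g2 (clamp p q t) y); [rewrite clamp_id by lra; reflexivity|].
  symmetry; apply is_derive_unique, hd, hy. }
rewrite e.
apply (is_derive_ext (fun v => RInt (fun t => g (clamp p q t) v) p q)).
{ intros v; apply RInt_ext; intros t; rewrite Rmin_left, Rmax_right by assumption.
  intros ht; rewrite clamp_id; lra. }
(* Clamping [t] makes the integrand differentiable for every [t], as the
   continuity of its derivative near the end points requires. *)
apply (is_derive_RInt_param (fun v t => g (clamp p q t) v)).
- apply (filter_imp (fun v => c < v < d)); [|now apply locally_between].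
  intros v hv t _; eexists; apply (hd v t hv).
- intros t _; apply continuity_2d_pt_ext_loc with (fun v t => g2 (clamp p q t) v);
    [|apply hc2].
  destruct (locally_between c d y hy) as [e1 h1]; exists e1.
  intros u v hu hv; symmetry; apply is_derive_unique, hd, h1, hu.
- apply filter_forall; intros v; apply ex_RInt_cont.
  intros t; apply (continuity_pt_comp (clamp p q) (fun s => g s v)).
  + apply (cont2_fst (fun x _ => clamp p q x) 0).
    now apply (C1_clamp_fst p q 0 0).
  + now apply cont2_fst.
Qed.

(** Differentiating the flux of [A] through the slice at height [y]: the divergence
    of (B, A) over the slice, less the flux of [B] through its end points. *)
Lemma flux_derive a b c d A A1 A2 B B1 B2 p q y : a < b ->
  is_C1 a b c d A A1 A2 -> is_C1 a b c d B B1 B2 -> a <= p -> p <= q -> q <= b -> c < y < d ->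
  is_derive (fun v => RInt (fun x => A x v) p q) y
    (RInt (fun x => A2 x y + B1 x y) p q - (B q y - B p y)).
Proof.
intros hab hA hB hp hpq hq hy.
assert (cA2 : cont2 A2) by apply hA.
assert (cB : cont2 B) by apply hB.
assert (cB1 : cont2 B1) by apply hB.
assert (e : RInt (fun x => B1 x y) p q = B q y - B p y).
{ apply (RInt_derive_open (fun x => B x y)); try assumption;
    try (intros x; now apply cont2_fst).
  intros x hx; apply hB; [lra|assumption]. }
assert (e' : RInt (fun x => A2 x y + B1 x y) p q =
  RInt (fun x => A2 x y) p q + RInt (fun x => B1 x y) p q).
{ apply (RInt_plus (V := R_CompleteNormedModule) (fun x => A2 x y) (fun x => B1 x y));
    apply ex_RInt_cont; intros x; now apply cont2_fst. }
rewrite e', e, Rplus_minus_r.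
now apply (is_derive_RInt_strip a b c d A A1 A2).
Qed.

(** A divergence-free field (B, A) with [B = 0] on the walls has the same flux
    through every slice. *)
Lemma flux_const a b c d A A1 A2 B B1 B2 : a < b ->
  is_C1 a b c d A A1 A2 -> is_C1 a b c d B B1 B2 ->
  (forall x y, a < x < b -> c < y < d -> A2 x y + B1 x y = 0) ->
  (forall y, c < y < d -> B a y = 0 /\ B b y = 0) ->
  forall y, c <= y <= d -> RInt (fun x => A x y) a b = RInt (fun x => A x c) a b.
Proof.
intros hab hA hB hdiv hwall y hy.
apply (derive_zero_const (fun v => RInt (fun x => A x v) a b) c y); [lra| |].
- intros v; apply (cont2_snd (fun x y => RInt (fun t => A t y) a x)).
  apply cont2_RInt, hA.
- intros v hv.
  replace 0 with (RInt (fun x => A2 x v + B1 x v) a b - (B b v - B a v)).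
  + apply (flux_derive a b c d A A1 A2 B B1 B2); try assumption; lra.
  + destruct (hwall v ltac:(lra)) as [-> ->].
    rewrite RInt_eq0; [ring|lra|].
    intros x hx; apply hdiv; lra.
Qed.

(** If the divergence is nonnegative, nothing crosses the walls, and the fluxes
    through the first and the last slice agree, then the divergence vanishes. *)
Lemma flux_zero a b c d A A1 A2 B B1 B2 : a < b -> c < d ->
  is_C1 a b c d A A1 A2 -> is_C1 a b c d B B1 B2 ->
  (forall x y, a < x < b -> c < y < d -> 0 <= A2 x y + B1 x y) ->
  (forall y, c < y < d -> B a y = 0 /\ B b y = 0) ->
  (forall x, a < x < b -> A x d = A x c) ->
  forall x y, a < x < b -> c < y < d -> A2 x y + B1 x y = 0.
Proof.
intros hab hcd hA hB hdiv hwall hper.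
set (I := fun v => RInt (fun x => A x v) a b).
assert (cI : continuity I).
{ intros v; apply (cont2_snd (fun x y => RInt (fun t => A t y) a x)).
  apply cont2_RInt, hA. }
assert (cK : cont2 (fun x y => A2 x y + B1 x y)).
{ apply cont2_plus; [apply hA|apply hB]. }
set (J := fun y => RInt (fun x => A2 x y + B1 x y) a b).
assert (cJ : continuity J).
{ intros v; apply (cont2_snd (fun x y => RInt (fun t => A2 t y + B1 t y) a x)).
  apply (cont2_RInt (fun x y => A2 x y + B1 x y)), cK. }
assert (dI : forall y, c < y < d -> is_derive I y (J y)).
{ intros y hy; replace (J y) with (J y - (B b y - B a y)).
  - apply (flux_derive a b c d A A1 A2 B B1 B2); try assumption; lra.
  - destruct (hwall y hy) as [-> ->]; ring. }
assert (hJ : forall y, c < y < d -> J y = 0).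
{ apply RInt_nonneg_eq0; try assumption.
  - intros y hy; apply RInt_ge_0; [lra| |].
    + apply ex_RInt_cont; intros x.
      now apply (cont2_fst (fun x y => A2 x y + B1 x y)).
    + intros x hx; now apply hdiv.
  - rewrite (RInt_derive_open I J); try assumption; [|lra].
    unfold I; rewrite (RInt_ext (fun x => A x d) (fun x => A x c)); [lra|].
    intros x; rewrite Rmin_left, Rmax_right by lra; apply hper. }
intros x y hx hy.
apply (RInt_nonneg_eq0 (fun x => A2 x y + B1 x y) a b); try assumption.
- intros t; now apply (cont2_fst (fun x y => A2 x y + B1 x y)).
- intros t ht; now apply hdiv.
- now apply hJ.
Qed.

(** Schwarz' theorem with named derivatives. *)
Lemma mixed_partials a b c d f f1 f2 f12 f21 :
  (forall x y, a < x < b -> c < y < d ->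
     is_derive (fun t => f t y) x (f1 x y) /\ is_derive (fun t => f x t) y (f2 x y) /\
     is_derive (fun t => f1 x t) y (f12 x y) /\ is_derive (fun t => f2 t y) x (f21 x y)) ->
  cont2 f12 -> cont2 f21 ->
  forall x y, a < x < b -> c < y < d -> f12 x y = f21 x y.
Proof.
intros hd c12 c21 x y hx hy.
assert (e1 : forall u v, a < u < b -> c < v < d -> Derive (fun z => f z v) u = f1 u v).
{ intros u v hu hv; now apply is_derive_unique, hd. }
assert (e2 : forall u v, a < u < b -> c < v < d -> Derive (fun z => f u z) v = f2 u v).
{ intros u v hu hv; now apply is_derive_unique, hd. }
assert (d12 : forall u v, a < u < b -> c < v < d ->
  is_derive (fun z => Derive (fun t => f t z) u) v (f12 u v)).
{ intros u v hu hv; apply is_derive_ext_loc with (fun z => f1 u z); [|now apply hd].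
  apply (filter_imp (fun z => c < z < d)); [|now apply locally_between].
  intros z hz; symmetry; now apply e1. }
assert (d21 : forall u v, a < u < b -> c < v < d ->
  is_derive (fun z => Derive (fun t => f z t) v) u (f21 u v)).
{ intros u v hu hv; apply is_derive_ext_loc with (fun z => f2 z v); [|now apply hd].
  apply (filter_imp (fun z => a < z < b)); [|now apply locally_between].
  intros z hz; symmetry; now apply e2. }
rewrite <- (is_derive_unique _ _ _ (d12 x y hx hy)),
  <- (is_derive_unique _ _ _ (d21 x y hx hy)).
symmetry; apply Schwarz.
- destruct (locally_2d_between a b c d x y hx hy) as [e he]; exists e.
  intros u v hu hv; destruct (he u v hu hv) as [hu' hv'].
  destruct (hd u v hu' hv') as (h1 & h2 & _).
  repeat split; eexists; [apply h1|apply h2|now apply d21|now apply d12].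
- apply continuity_2d_pt_ext_loc with f21; [|apply c21].
  destruct (locally_2d_between a b c d x y hx hy) as [e he]; exists e.
  intros u v hu hv; destruct (he u v hu hv) as [hu' hv'].
  symmetry; apply is_derive_unique; now apply d21.
- apply continuity_2d_pt_ext_loc with f12; [|apply c12].
  destruct (locally_2d_between a b c d x y hx hy) as [e he]; exists e.
  intros u v hu hv; destruct (he u v hu hv) as [hu' hv'].
  symmetry; apply is_derive_unique; now apply d12.
Qed.

(** * The Euler equations in polar coordinates *)

Lemma is_derive_polar g r th : differentiable_at g (polar r th) ->
  is_derive (fun t => g (polar t th)) r
    (cos th * D1 g (polar r th) + sin th * D2 g (polar r th)) /\
  is_derive (fun t => g (polar r t)) th
    (- (r * sin th) * D1 g (polar r th) + r * cos th * D2 g (polar r th)).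
Proof.
intros (l1 & l2 & hl).
assert (hl' := hl); apply differentiable_pt_lim_unique in hl'; destruct hl' as [e1 e2].
assert (f1 : D1 g (polar r th) = l1) by exact e1.
assert (f2 : D2 g (polar r th) = l2) by exact e2.
rewrite f1, f2; split; apply is_derive_Reals.
- replace (cos th * l1 + sin th * l2) with (l1 * cos th + l2 * sin th) by ring.
  apply (derivable_pt_lim_comp_2d (fun x y => g (x, y)) (fun t => t * cos th)
    (fun t => t * sin th)); [exact hl| |].
  + apply is_derive_Reals; auto_derive; [trivial|ring].
  + apply is_derive_Reals; auto_derive; [trivial|ring].
- replace (- (r * sin th) * l1 + r * cos th * l2) with
    (l1 * (- (r * sin th)) + l2 * (r * cos th)) by ring.
  apply (derivable_pt_lim_comp_2d (fun x y => g (x, y)) (fun t => r * cos t)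
    (fun t => r * sin t)); [exact hl| |].
  + apply is_derive_Reals; auto_derive; [trivial|ring].
  + apply is_derive_Reals; auto_derive; [trivial|ring].
Qed.

(** Divergence equation and pressure gradient in terms of the partial derivatives of
    the polar components. *)
Lemma Euler_polar a b th0 u P ut ur : 0 <= a ->
  (forall r th, open_rect a b 0 th0 (r, th) -> u (polar r th) = polar_field ut ur r th) ->
  stationary_Euler (Omega a b th0) u P ->
  forall r th utr utt urr urt, a < r < b -> 0 < th < th0 ->
    is_derive (fun t => ut t th) r utr -> is_derive (fun t => ut r t) th utt ->
    is_derive (fun t => ur t th) r urr -> is_derive (fun t => ur r t) th urt ->
    r * urr + ur r th + utt = 0 /\
    is_derive (fun t => P (polar t th)) r
      ((ut r th * ut r th - ut r th * urt) / r - ur r th * urr) /\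
    is_derive (fun t => P (polar r t)) th
      (- (r * (ur r th * utr) + ut r th * utt + ur r th * ut r th)).
Proof.
intros ha hu hE r th utr utt urr urt hr hth dtr dtt drr drt.
assert (hin : Omega a b th0 (polar r th)).
{ exists r, th; auto. }
destruct (hE _ hin) as (h1 & h2 & hP & m1 & m2 & hdiv).
assert (hu1 : forall s t, a < s < b -> 0 < t < th0 ->
  fst (u (polar s t)) = - (ut s t * sin t) + ur s t * cos t).
{ intros s t hs ht; rewrite hu by (split; assumption).
  change (ut s t * - sin t + ur s t * cos t = - (ut s t * sin t) + ur s t * cos t); ring. }
assert (hu2 : forall s t, a < s < b -> 0 < t < th0 ->
  snd (u (polar s t)) = ut s t * cos t + ur s t * sin t).
{ intros s t hs ht; rewrite hu by (split; assumption).
  reflexivity. }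
destruct (is_derive_polar _ r th h1) as [p1 q1].
destruct (is_derive_polar _ r th h2) as [p2 q2].
destruct (is_derive_polar _ r th hP) as [p3 q3].
rewrite (hu1 r th hr hth), (hu2 r th hr hth) in m1, m2.
set (a1 := D1 (fun z => fst (u z)) (polar r th)) in *.
set (b1 := D2 (fun z => fst (u z)) (polar r th)) in *.
set (a2 := D1 (fun z => snd (u z)) (polar r th)) in *.
set (b2 := D2 (fun z => snd (u z)) (polar r th)) in *.
assert (etr : Derive (fun t : R => ut t th) r = utr) by now apply is_derive_unique.
assert (err : Derive (fun t : R => ur t th) r = urr) by now apply is_derive_unique.
assert (ett : Derive (fun t : R => ut r t) th = utt) by now apply is_derive_unique.
assert (ert : Derive (fun t : R => ur r t) th = urt) by now apply is_derive_unique.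
assert (E1 : cos th * a1 + sin th * b1 = - (utr * sin th) + urr * cos th).
{ rewrite <- (is_derive_unique _ _ _ p1); apply is_derive_unique.
  apply is_derive_ext_loc with (fun t => - (ut t th * sin th) + ur t th * cos th).
  - apply (filter_imp (fun t => a < t < b)); [|now apply locally_between].
    intros t ht; symmetry; now apply hu1.
  - auto_derive; [repeat split; eexists; eassumption|].
    rewrite etr, err; ring. }
assert (E2 : cos th * a2 + sin th * b2 = utr * cos th + urr * sin th).
{ rewrite <- (is_derive_unique _ _ _ p2); apply is_derive_unique.
  apply is_derive_ext_loc with (fun t => ut t th * cos th + ur t th * sin th).
  - apply (filter_imp (fun t => a < t < b)); [|now apply locally_between].
    intros t ht; symmetry; now apply hu2.
  - auto_derive; [repeat split; eexists; eassumption|].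
    rewrite etr, err; ring. }
assert (E3 : - (r * sin th) * a1 + r * cos th * b1 =
   - (utt * sin th + ut r th * cos th) + (urt * cos th - ur r th * sin th)).
{ rewrite <- (is_derive_unique _ _ _ q1); apply is_derive_unique.
  apply is_derive_ext_loc with (fun t => - (ut r t * sin t) + ur r t * cos t).
  - apply (filter_imp (fun t => 0 < t < th0)); [|now apply locally_between].
    intros t ht; symmetry; now apply hu1.
  - auto_derive; [repeat split; eexists; eassumption|].
    rewrite ett, ert; ring. }
assert (E4 : - (r * sin th) * a2 + r * cos th * b2 =
   (utt * cos th - ut r th * sin th) + (urt * sin th + ur r th * cos th)).
{ rewrite <- (is_derive_unique _ _ _ q2); apply is_derive_unique.
  apply is_derive_ext_loc with (fun t => ut r t * cos t + ur r t * sin t).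
  - apply (filter_imp (fun t => 0 < t < th0)); [|now apply locally_between].
    intros t ht; symmetry; now apply hu2.
  - auto_derive; [repeat split; eexists; eassumption|].
    rewrite ett, ert; ring. }
assert (hsc : sin th * sin th + cos th * cos th = 1) by apply sin2_cos2.
assert (hr0 : r <> 0) by lra.
set (s := sin th) in *; set (k := cos th) in *.
set (U := ur r th) in *; set (V := ut r th) in *.
set (X1 := - (utr * s) + urr * k) in *.
set (X2 := utr * k + urr * s) in *.
set (Y1 := - (utt * s + V * k) + (urt * k - U * s)) in *.
set (Y2 := (utt * k - V * s) + (urt * s + U * k)) in *.
assert (A1 : r * a1 = r * k * X1 - s * Y1).
{ rewrite <- E1, <- E3.
  transitivity (r * a1 * (s * s + k * k)); [rewrite hsc|]; ring. }
assert (B1 : r * b1 = r * s * X1 + k * Y1).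
{ rewrite <- E1, <- E3.
  transitivity (r * b1 * (s * s + k * k)); [rewrite hsc|]; ring. }
assert (A2 : r * a2 = r * k * X2 - s * Y2).
{ rewrite <- E2, <- E4.
  transitivity (r * a2 * (s * s + k * k)); [rewrite hsc|]; ring. }
assert (B2 : r * b2 = r * s * X2 + k * Y2).
{ rewrite <- E2, <- E4.
  transitivity (r * b2 * (s * s + k * k)); [rewrite hsc|]; ring. }
(* A1, B1, A2, B2 invert the chain rule; the advection operator becomes
   [U] times the radial plus [V / r] times the angular derivative. *)
assert (M1 : - (r * D1 P (polar r th)) = r * U * X1 + V * Y1).
{ transitivity ((- (V * s) + U * k) * (r * a1) + (V * k + U * s) * (r * b1)).
  - transitivity (r * - D1 P (polar r th)); [ring|rewrite <- m1; ring].
  - rewrite A1, B1.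
    transitivity ((r * U * X1 + V * Y1) * (s * s + k * k)); [|rewrite hsc]; ring. }
assert (M2 : - (r * D2 P (polar r th)) = r * U * X2 + V * Y2).
{ transitivity ((- (V * s) + U * k) * (r * a2) + (V * k + U * s) * (r * b2)).
  - transitivity (r * - D2 P (polar r th)); [ring|rewrite <- m2; ring].
  - rewrite A2, B2.
    transitivity ((r * U * X2 + V * Y2) * (s * s + k * k)); [|rewrite hsc]; ring. }
split; [|split].
- transitivity (r * (a1 + b2)); [|rewrite hdiv; ring].
  rewrite Rmult_plus_distr_l, A1, B2; unfold X1, X2, Y1, Y2.
  transitivity ((r * urr + U + utt) * (s * s + k * k)); [rewrite hsc|]; ring.
- match goal with |- is_derive _ _ ?l =>
    replace l with (k * D1 P (polar r th) + s * D2 P (polar r th)); [exact p3|] end.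
  apply Rmult_eq_reg_l with r; [|assumption].
  transitivity (- (k * (- (r * D1 P (polar r th))) + s * (- (r * D2 P (polar r th)))));
    [ring|].
  rewrite M1, M2.
  transitivity ((V * V - V * urt - r * (U * urr)) * (s * s + k * k));
    [unfold X1, X2, Y1, Y2; ring|rewrite hsc; field; assumption].
- match goal with |- is_derive _ _ ?l =>
    replace l with (- (r * s) * D1 P (polar r th) + r * k * D2 P (polar r th));
      [exact q3|] end.
  transitivity (s * (- (r * D1 P (polar r th))) - k * (- (r * D2 P (polar r th))));
    [ring|].
  rewrite M1, M2.
  transitivity (- (r * (U * utr) + V * utt + U * V) * (s * s + k * k));
    [unfold X1, X2, Y1, Y2; ring|rewrite hsc; ring].
Qed.

(** * Sign of a nonvanishing function; the square of the positive part *)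

Lemma zero_closed a b c d F : a < b -> c < d -> cont2 F ->
  (forall x y, a < x < b -> c < y < d -> F x y = 0) ->
  forall x y, a <= x <= b -> c <= y <= d -> F x y = 0.
Proof.
intros hab hcd hF h0.
assert (h1 : forall x y, a < x < b -> c <= y <= d -> F x y = 0).
{ intros x y hx hy; apply Rabs_eq_0, Rle_antisym; [|apply Rabs_pos].
  apply (le0_closed (fun v => Rabs (F x v)) c d y 1); try assumption; try lra.
  - apply (continuity_pt_comp (fun v => F x v) Rabs); [now apply cont2_snd|].
    apply Rcontinuity_abs.
  - intros v hv _; rewrite h0, Rabs_R0; try assumption; lra. }
intros x y hx hy; apply Rabs_eq_0, Rle_antisym; [|apply Rabs_pos].
apply (le0_closed (fun u => Rabs (F u y)) a b x 1); try assumption; try lra.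
- apply (continuity_pt_comp (fun u => F u y) Rabs); [now apply cont2_fst|].
  apply Rcontinuity_abs.
- intros u hu _; rewrite h1, Rabs_R0; try assumption; lra.
Qed.

Lemma cont2_same_sign F x y x' y' : cont2 F -> (forall u v, F u v <> 0) ->
  0 < F x y * F x' y'.
Proof.
intros hF h0.
assert (sgn : forall f : R -> R, continuity f -> (forall t, f t <> 0) ->
  forall s t, 0 < f s * f t).
{ intros f cf hf.
  assert (ord : forall s t, s <= t -> 0 < f s * f t).
  { intros s t hst; destruct (Rlt_le_dec 0 (f s * f t)) as [|hle]; [assumption|].
    destruct (IVT_cor f s t cf hst hle) as (z & _ & hz); destruct (hf z hz). }
  intros s t; destruct (Rle_lt_dec s t); [now apply ord|].
  rewrite Rmult_comm; apply ord; lra. }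
assert (h1 : 0 < F x y * F x' y).
{ apply (sgn (fun t => F t y)); [intros t; now apply cont2_fst|auto]. }
assert (h2 : 0 < F x' y * F x' y').
{ apply (sgn (fun t => F x' t)); [intros t; now apply cont2_snd|auto]. }
assert (h3 := Rmult_lt_0_compat _ _ h1 h2).
assert (h4 : 0 < F x' y * F x' y).
{ apply Rlt_0_sqr, h0. }
apply Rmult_lt_reg_r with (1 := h4); rewrite Rmult_0_l.
replace (F x y * F x' y' * (F x' y * F x' y)) with
  (F x y * F x' y * (F x' y * F x' y')) by ring; assumption.
Qed.

(** The square of the positive part, a C^1 function. *)
Definition pos_sq (x : R) : R := Rmax 0 x * Rmax 0 x.

Lemma pos_sq_pos x : 0 < x -> 0 < pos_sq x.
Proof. intros h; unfold pos_sq; rewrite Rmax_right by lra; now apply Rmult_lt_0_compat. Qed.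

Lemma pos_sq_neg x : x <= 0 -> pos_sq x = 0.
Proof. intros h; unfold pos_sq; rewrite Rmax_left by lra; ring. Qed.

Lemma pos_sq_ge0 x : 0 <= pos_sq x.
Proof. apply Rle_0_sqr. Qed.

Lemma is_derive_pos_sq x : is_derive pos_sq x (2 * Rmax 0 x).
Proof.
destruct (Rtotal_order x 0) as [hx|[->|hx]].
- rewrite Rmax_left by lra; rewrite Rmult_0_r.
  apply is_derive_ext_loc with (fun _ => 0); [|apply @is_derive_const].
  apply (filter_imp (fun t => t < 0)); [|now apply open_lt].
  intros t ht; symmetry; apply pos_sq_neg; lra.
- rewrite Rmax_left by lra; rewrite Rmult_0_r.
  apply is_derive_Reals; intros eps heps; exists (mkposreal eps heps).
  intros h hh0 hh; simpl in hh.
  rewrite Rplus_0_l, (pos_sq_neg 0), !Rminus_0_r by lra.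
  unfold pos_sq, Rmax; destruct Rle_dec as [h1|h1].
  + replace (h * h / h) with h by (field; assumption); assumption.
  + unfold Rdiv; rewrite !Rmult_0_l, Rabs_R0; assumption.
- rewrite Rmax_right by lra.
  apply is_derive_ext_loc with (fun t => t * t).
  + apply (filter_imp (fun t => 0 < t)); [|now apply open_gt].
    intros t ht; unfold pos_sq; rewrite Rmax_right; lra.
  + auto_derive; [trivial|ring].
Qed.

Lemma continuity_pos_sq' : continuity (fun x => 2 * Rmax 0 x).
Proof.
intros x; apply continuity_pt_filterlim, filterlim_locally; intros eps.
assert (h : 0 < eps / 2) by (assert (h := cond_pos eps); lra).
exists (mkposreal _ h); intros t ht; change (Rabs (t - x) < eps / 2) in ht.
change (Rabs (2 * Rmax 0 t - 2 * Rmax 0 x) < eps).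
apply Rabs_def2 in ht.
apply Rabs_def1; unfold Rmax; repeat destruct Rle_dec; lra.
Qed.

(** * Flows in a polar rectangle *)

Section Flow.

(** [V] and [U] are the angular and radial velocities on [a,b] x [0,th0]; a suffix 1
    stands for the derivative in [r] (written [x]), a suffix 2 for the derivative in
    the angle (written [y]).  [p] is the pressure. *)

Variables (a b th0 : R).
Hypotheses (ha : 0 < a) (hab : a < b) (hth0 : 0 < th0).
Variables (V V1 V2 V11 V12 V21 V22 U U1 U2 U11 U12 U21 U22 p : R -> R -> R).
Hypotheses (hV : is_C1 a b 0 th0 V V1 V2) (hV1 : is_C1 a b 0 th0 V1 V11 V12)
  (hV2 : is_C1 a b 0 th0 V2 V21 V22).
Hypotheses (hU : is_C1 a b 0 th0 U U1 U2) (hU1 : is_C1 a b 0 th0 U1 U11 U12)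
  (hU2 : is_C1 a b 0 th0 U2 U21 U22).
Hypothesis hdiv : forall x y, a < x < b -> 0 < y < th0 -> x * U1 x y + U x y + V2 x y = 0.
Hypothesis hp : forall x y, a < x < b -> 0 < y < th0 ->
  is_derive (fun t => p t y) x ((V x y * V x y - V x y * U2 x y) / x - U x y * U1 x y) /\
  is_derive (fun t => p x t) y
    (- (x * (U x y * V1 x y) + V x y * V2 x y + U x y * V x y)).
Hypothesis hV0 : forall x y, V x y <> 0.
Hypothesis hwall : forall y, 0 <= y <= th0 -> U a y = 0 /\ U b y = 0.
Hypothesis hVper : forall x, a <= x <= b -> V x 0 = V x th0.
Hypothesis hUper : forall x, a <= x <= b -> U x 0 = U x th0.

(** The function r, clamped so that it is positive on the whole plane. *)
Let rho (x y : R) : R := clamp a b x.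

Lemma rho_C1 : is_C1 a b 0 th0 rho (fun _ _ => 1) (fun _ _ => 0).
Proof. apply C1_clamp_fst; lra. Qed.

Lemma rho_neq0 x y : rho x y <> 0.
Proof. assert (h := clamp_in a b x ltac:(lra)); unfold rho; lra. Qed.

Lemma rho_id x y : a <= x <= b -> rho x y = x.
Proof. apply clamp_id. Qed.

Lemma V12_V21 x y : a < x < b -> 0 < y < th0 -> V12 x y = V21 x y.
Proof.
apply (mixed_partials a b 0 th0 V V1 V2); [|apply hV1|apply hV2].
intros u v hu hv; split; [|split; [|split]];
  [now apply hV|now apply hV|now apply hV1|now apply hV2].
Qed.

Lemma U12_U21 x y : a < x < b -> 0 < y < th0 -> U12 x y = U21 x y.
Proof.
apply (mixed_partials a b 0 th0 U U1 U2); [|apply hU1|apply hU2].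
intros u v hu hv; split; [|split; [|split]];
  [now apply hU|now apply hU|now apply hU1|now apply hU2].
Qed.

(** The divergence equation differentiated in [x] and in [y]. *)
Lemma div_derive x y : a < x < b -> 0 < y < th0 ->
  2 * U1 x y + x * U11 x y + V21 x y = 0 /\ x * U12 x y + U2 x y + V22 x y = 0.
Proof.
intros hx hy.
destruct (C1_plus _ _ _ _ _ _ _ _ _ _ (C1_plus _ _ _ _ _ _ _ _ _ _
  (C1_mult _ _ _ _ _ _ _ _ _ _ rho_C1 hU1) hU) hV2) as (_ & _ & _ & hd).
destruct (hd x y hx hy) as [d1 d2]; clear hd; split.
- apply is_derive_unique in d1; rewrite rho_id in d1 by lra.
  transitivity (1 * U1 x y + x * U11 x y + U1 x y + V21 x y); [ring|].
  rewrite <- d1; transitivity (Derive (fun _ => 0) x); [|apply Derive_const].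
  apply Derive_ext_loc, (filter_imp (fun t => a < t < b)); [|now apply locally_between].
  intros t ht; rewrite rho_id by lra; now apply hdiv.
- apply is_derive_unique in d2; rewrite rho_id in d2 by lra.
  transitivity (0 * U1 x y + x * U12 x y + U2 x y + V22 x y); [ring|].
  rewrite <- d2; transitivity (Derive (fun _ => 0) y); [|apply Derive_const].
  apply Derive_ext_loc, (filter_imp (fun t => 0 < t < th0)); [|now apply locally_between].
  intros t ht; rewrite rho_id by lra; now apply hdiv.
Qed.

(** [Z] is r times the vorticity. *)
Let Z (x y : R) : R := V x y + rho x y * V1 x y - U2 x y.
Let Z1 (x y : R) : R := V1 x y + (1 * V1 x y + rho x y * V11 x y) - U21 x y.
Let Z2 (x y : R) : R := V2 x y + (0 * V1 x y + rho x y * V12 x y) - U22 x y.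

Lemma Z_C1 : is_C1 a b 0 th0 Z Z1 Z2.
Proof.
apply (C1_minus _ _ _ _ _ _ _ _ _ _ (C1_plus _ _ _ _ _ _ _ _ _ _ hV
  (C1_mult _ _ _ _ _ _ _ _ _ _ rho_C1 hV1)) hU2).
Qed.

(** The vorticity and its derivatives. *)
Let w (x y : R) : R := Z x y / rho x y.
Let w1 (x y : R) : R := (Z1 x y * rho x y - Z x y * 1) / (rho x y * rho x y).
Let w2 (x y : R) : R := (Z2 x y * rho x y - Z x y * 0) / (rho x y * rho x y).

Lemma w_C1 : is_C1 a b 0 th0 w w1 w2.
Proof. apply (C1_div _ _ _ _ _ _ _ _ _ _ Z_C1 rho_C1 rho_neq0). Qed.

(** Transport of the vorticity, multiplied by r^2: the curl of the pressure gradient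
    vanishes. *)
Lemma Z_transport x y : a < x < b -> 0 < y < th0 ->
  U x y * (x * Z1 x y - Z x y) + V x y * Z2 x y = 0.
Proof.
intros hx hy.
assert (hx0 : x <> 0) by lra.
assert (P1 := C1_minus _ _ _ _ _ _ _ _ _ _ (C1_div _ _ _ _ _ _ _ _ _ _
  (C1_minus _ _ _ _ _ _ _ _ _ _ (C1_mult _ _ _ _ _ _ _ _ _ _ hV hV)
   (C1_mult _ _ _ _ _ _ _ _ _ _ hV hU2)) rho_C1 rho_neq0)
  (C1_mult _ _ _ _ _ _ _ _ _ _ hU hU1)).
assert (P2 := C1_minus _ _ _ _ _ _ _ _ _ _ (C1_const a b 0 th0 0)
  (C1_plus _ _ _ _ _ _ _ _ _ _ (C1_plus _ _ _ _ _ _ _ _ _ _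
   (C1_mult _ _ _ _ _ _ _ _ _ _ rho_C1 (C1_mult _ _ _ _ _ _ _ _ _ _ hU hV1))
   (C1_mult _ _ _ _ _ _ _ _ _ _ hV hV2)) (C1_mult _ _ _ _ _ _ _ _ _ _ hU hV))).
destruct P1 as (_ & _ & c12 & d1); destruct P2 as (_ & c21 & _ & d2).
assert (curl := fun H => mixed_partials a b 0 th0 p
  (fun x y => (V x y * V x y - V x y * U2 x y) / rho x y - U x y * U1 x y)
  (fun x y => 0 - (rho x y * (U x y * V1 x y) + V x y * V2 x y + U x y * V x y))
  _ _ H c12 c21 x y hx hy).
cbv beta in curl.
match type of curl with ?H -> _ => assert (h : H) end.
{ intros s t hs ht; destruct (d1 s t hs ht) as [_ e1], (d2 s t hs ht) as [e2 _].
  split; [|split; [|split]]; [| |exact e1|exact e2].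
  - rewrite rho_id by lra; now apply hp.
  - rewrite rho_id, Rminus_0_l by lra; now apply hp. }
specialize (curl h); clear h d1 d2 c12 c21.
unfold Z, Z1, Z2; rewrite rho_id in curl |- * by lra.
assert (e12 := V12_V21 x y hx hy); assert (f12 := U12_U21 x y hx hy).
rewrite <- e12, f12 in curl.
assert (D := hdiv x y hx hy).
match type of curl with ?l = ?r => assert (curl' : x * l - x * r = 0)
  by (rewrite curl; ring) end.
match type of curl' with ?c = 0 =>
  transitivity (c - (V x y - U2 x y + x * V1 x y) * (x * U1 x y + U x y + V2 x y)) end.
- field; assumption.
- rewrite curl', D; ring.
Qed.

(** [Q] is constant along the flow; [Q1], [Q2] are its derivatives. *)
Definition transported (Q Q1 Q2 : R -> R -> R) : Prop :=
  is_C1 a b 0 th0 Q Q1 Q2 /\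
  forall x y, a < x < b -> 0 < y < th0 -> x * U x y * Q1 x y + V x y * Q2 x y = 0.

Lemma transported_w : transported w w1 w2.
Proof.
split; [apply w_C1|]; intros x y hx hy.
assert (h := Z_transport x y hx hy).
unfold w1, w2; rewrite rho_id by lra.
transitivity ((U x y * (x * Z1 x y - Z x y) + V x y * Z2 x y) * / x);
  [field; lra|rewrite h; ring].
Qed.

Lemma transported_const k : transported (fun _ _ => k) (fun _ _ => 0) (fun _ _ => 0).
Proof. split; [apply C1_const|]; intros; ring. Qed.

Lemma transported_minus f f1 f2 g g1 g2 : transported f f1 f2 -> transported g g1 g2 ->
  transported (fun x y => f x y - g x y) (fun x y => f1 x y - g1 x y)
    (fun x y => f2 x y - g2 x y).
Proof.
intros [hf tf] [hg tg]; split; [now apply C1_minus|]; intros x y hx hy.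
transitivity ((x * U x y * f1 x y + V x y * f2 x y) -
  (x * U x y * g1 x y + V x y * g2 x y)); [ring|].
rewrite (tf x y hx hy), (tg x y hx hy); ring.
Qed.

Lemma transported_mult f f1 f2 g g1 g2 : transported f f1 f2 -> transported g g1 g2 ->
  transported (fun x y => f x y * g x y) (fun x y => f1 x y * g x y + f x y * g1 x y)
    (fun x y => f2 x y * g x y + f x y * g2 x y).
Proof.
intros [hf tf] [hg tg]; split; [now apply C1_mult|]; intros x y hx hy.
transitivity ((x * U x y * f1 x y + V x y * f2 x y) * g x y +
  (x * U x y * g1 x y + V x y * g2 x y) * f x y); [ring|].
rewrite (tf x y hx hy), (tg x y hx hy); ring.
Qed.

Lemma transported_comp h h' f f1 f2 : (forall x, is_derive h x (h' x)) ->
  continuity h' -> transported f f1 f2 ->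
  transported (fun x y => h (f x y)) (fun x y => f1 x y * h' (f x y))
    (fun x y => f2 x y * h' (f x y)).
Proof.
intros dh ch [hf tf]; split; [now apply C1_comp|]; intros x y hx hy.
transitivity ((x * U x y * f1 x y + V x y * f2 x y) * h' (f x y)); [ring|].
rewrite (tf x y hx hy); ring.
Qed.

Lemma transported_flux Q Q1 Q2 y : transported Q Q1 Q2 -> 0 <= y <= th0 ->
  RInt (fun x => V x y * Q x y) a b = RInt (fun x => V x 0 * Q x 0) a b.
Proof.
intros [hQ tQ] hy.
apply (flux_const a b 0 th0 _ _ _ _ _ _ hab (C1_mult _ _ _ _ _ _ _ _ _ _ hV hQ)
  (C1_mult _ _ _ _ _ _ _ _ _ _ (C1_mult _ _ _ _ _ _ _ _ _ _ rho_C1 hU) hQ));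
  [| |assumption].
- intros u v hu hv; rewrite rho_id by lra.
  transitivity ((u * U1 u v + U u v + V2 u v) * Q u v +
    (u * U u v * Q1 u v + V u v * Q2 u v)); [ring|].
  rewrite (tQ u v hu hv), (hdiv u v hu hv); ring.
- intros v hv; destruct (hwall v ltac:(lra)) as [-> ->]; split; ring.
Qed.

(** The stream function that vanishes on the inner wall. *)
Let psi (x y : R) : R := RInt (fun t => V t y) a x.

Lemma cont_V y : continuity (fun t => V t y).
Proof. intros t; apply cont2_fst, hV. Qed.

Lemma transported_psi : transported psi V (fun x y => - (rho x y * U x y)).
Proof.
assert (hrU := C1_mult _ _ _ _ _ _ _ _ _ _ rho_C1 hU).
split.
- split; [apply cont2_RInt, hV|split; [apply hV|split; [apply cont2_opp, hrU|]]].
  intros x y hx hy; split.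
  + apply (is_derive_primitive (fun t => V t y)), cont_V.
  + assert (d := flux_derive a b 0 th0 _ _ _ _ _ _ a x y hab hV hrU
      ltac:(lra) ltac:(lra) ltac:(lra) hy).
    cbv beta in d; destruct (hwall y ltac:(lra)) as [e _]; rewrite e in d.
    match type of d with is_derive _ _ ?l =>
      replace (- (rho x y * U x y)) with l; [exact d|] end.
    rewrite RInt_eq0; [ring|lra|].
    intros t ht; rewrite rho_id by lra.
    transitivity (t * U1 t y + U t y + V2 t y); [ring|apply hdiv; lra].
- intros x y hx hy; rewrite rho_id by lra; ring.
Qed.

Lemma V_same_sign x y x' y' : 0 < V x y * V x' y'.
Proof. apply cont2_same_sign; [apply hV|apply hV0]. Qed.

(** A sign of the vorticity on one ray [y = e] spreads to the whole rectangle. *)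
Lemma vorticity_sign k e : (forall x y, 0 < k * V x y) -> 0 <= e <= th0 ->
  (forall x, a < x < b -> k * w x e <= 0) ->
  forall x y, a < x < b -> 0 <= y <= th0 -> k * w x y <= 0.
Proof.
intros hk he hsgn x y hx hy.
assert (hQ := transported_comp _ _ _ _ _ is_derive_pos_sq continuity_pos_sq'
  (transported_mult _ _ _ _ _ _ (transported_const k) transported_w)).
assert (hI : RInt (fun x => V x y * pos_sq (k * w x y)) a b = 0).
{ rewrite (transported_flux _ _ _ y hQ hy), <- (transported_flux _ _ _ e hQ he).
  apply RInt_eq0; [lra|]; intros t ht.
  rewrite pos_sq_neg, Rmult_0_r; auto. }
assert (cQ : continuity (fun x => V x y * pos_sq (k * w x y))).
{ intros t; apply continuity_pt_mult; [apply cont_V|].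
  apply (cont2_fst (fun x y => pos_sq (k * w x y))), hQ. }
assert (h := RInt_nonneg_eq0 (fun x => k * (V x y * pos_sq (k * w x y))) a b hab).
assert (h0 : k * (V x y * pos_sq (k * w x y)) = 0).
{ apply h; [|  | |assumption].
  - intros t; apply continuity_pt_scal, cQ.
  - intros t ht; rewrite <- Rmult_assoc; apply Rmult_le_pos; [left; apply hk|].
    apply pos_sq_ge0.
  - rewrite (RInt_scal (V := R_CompleteNormedModule) _ a b k) by now apply ex_RInt_cont.
    rewrite hI; apply Rmult_0_r. }
rewrite <- Rmult_assoc in h0.
apply Rmult_integral in h0; destruct h0 as [h0|h0]; [assert (h1 := hk x y); lra|].
destruct (Rle_lt_dec (k * w x y) 0) as [|hpos]; [assumption|].
apply pos_sq_pos in hpos; lra.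
Qed.

Lemma psi_diff_sign x x' : x < x' -> 0 < V a 0 * (psi x' 0 - psi x 0).
Proof.
intros hx.
destruct (MVT_gen (fun t => psi t 0) x x' (fun t => V t 0)) as (xi & _ & e).
- intros t _; apply (is_derive_primitive (fun s => V s 0)), cont_V.
- intros t _; apply (cont2_fst psi), transported_psi.
- simpl in e; rewrite e, <- Rmult_assoc.
  apply Rmult_lt_0_compat; [apply V_same_sign|lra].
Qed.

Lemma psi_per x : a <= x <= b -> psi x th0 = psi x 0.
Proof.
intros hx; apply RInt_ext; intros t; rewrite Rmin_left, Rmax_right by lra.
intros ht; symmetry; apply hVper; lra.
Qed.

(** The vorticity takes the same values at both ends of each stream line, and a stream
    line starts and ends at the same radius. *)
Lemma vorticity_per x : a < x < b -> w x th0 = w x 0.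
Proof.
intros hx.
set (M := fun t => w t th0 - w t 0).
assert (cM : continuity M).
{ intros t; apply continuity_pt_minus; apply cont2_fst, w_C1. }
destruct (Req_dec (M x) 0) as [h0|hM]; [unfold M in h0; lra|exfalso].
assert (hM2 : 0 < M x * M x) by now apply Rlt_0_sqr.
assert (cMx : continuity_pt (fun t => M x * M t) x) by apply continuity_pt_scal, cM.
apply continuity_pt_filterlim in cMx.
destruct (proj1 (filterlim_locally _ _) cMx (mkposreal _ hM2)) as [del hdel].
assert (hdel0 := cond_pos del).
set (m := Rmin (del / 2) (Rmin ((x - a) / 2) ((b - x) / 2))).
assert (hm : 0 < m /\ m < del /\ a < x - m /\ x + m < b).
{ unfold m, Rmin; repeat destruct Rle_dec; lra. }
(* As a function of [t], [B t 0] is positive exactly on (x - m, x + m), where the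
   difference [M] of the two vorticities has the sign of [M x]. *)
set (p1 := psi (x - m) 0); set (p2 := psi (x + m) 0).
set (B := fun x y => pos_sq ((psi x y - p1) * (p2 - psi x y))).
assert (hB : exists B1 B2, transported B B1 B2).
{ do 2 eexists.
  exact (transported_comp _ _ _ _ _ is_derive_pos_sq continuity_pos_sq'
    (transported_mult _ _ _ _ _ _
      (transported_minus _ _ _ _ _ _ transported_psi (transported_const p1))
      (transported_minus _ _ _ _ _ _ (transported_const p2) transported_psi))). }
destruct hB as (B1 & B2 & hB).
assert (hQ := transported_mult _ _ _ _ _ _ transported_w hB).
assert (hI := transported_flux _ _ _ th0 hQ ltac:(lra)); cbv beta in hI.
assert (hBper : forall t, a <= t <= b -> B t th0 = B t 0).
{ intros t ht; unfold B; now rewrite psi_per. }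
assert (cB : forall y, continuity (fun t => B t y)).
{ intros y t; apply cont2_fst, hB. }
assert (cw : forall y, continuity (fun t => w t y)).
{ intros y t; apply cont2_fst, w_C1. }
assert (hI0 : RInt (fun t => V t 0 * (M t * B t 0)) a b = 0).
{ rewrite (RInt_ext (fun t => V t th0 * (w t th0 * B t th0))
    (fun t => V t 0 * (w t th0 * B t 0))) in hI.
  2: { intros t; rewrite Rmin_left, Rmax_right by lra; intros ht.
       rewrite hBper, (hVper t) by lra; reflexivity. }
  assert (e := RInt_minus (V := R_CompleteNormedModule)
    (fun t => V t 0 * (w t th0 * B t 0)) (fun t => V t 0 * (w t 0 * B t 0)) a b
    ltac:(apply ex_RInt_cont; intros t; apply continuity_pt_mult;
      [apply cont_V|apply continuity_pt_mult; [apply cw|apply cB]])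
    ltac:(apply ex_RInt_cont; intros t; apply continuity_pt_mult;
      [apply cont_V|apply continuity_pt_mult; [apply cw|apply cB]])).
  rewrite hI, minus_eq_zero in e; etransitivity; [|exact e].
  apply RInt_ext; intros t _; unfold M, minus, plus, opp; simpl; ring. }
assert (hsgn : forall s t, s < t ->  0 < V a 0 * (psi t 0 - psi s 0)) by apply psi_diff_sign.
assert (hin : forall t, x - m < t < x + m -> 0 < B t 0).
{ intros t ht; apply pos_sq_pos.
  assert (q1 := hsgn (x - m) t ltac:(lra)); assert (q2 := hsgn t (x + m) ltac:(lra)).
  fold p1 in q1; fold p2 in q2.
  assert (q3 := Rmult_lt_0_compat _ _ q1 q2).
  assert (q4 : 0 < V a 0 * V a 0) by apply V_same_sign.
  apply Rmult_lt_reg_l with (1 := q4); rewrite Rmult_0_r.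
  eapply Rlt_le_trans; [exact q3|right; ring]. }
assert (hout : forall t, ~ (x - m < t < x + m) -> B t 0 = 0).
{ intros t ht; apply pos_sq_neg.
  assert (q4 : 0 < V a 0 * V a 0) by apply V_same_sign.
  assert (q5 := hsgn (x - m) (x + m) ltac:(lra)).
  fold p1 p2 in q5.
  assert (q : 0 <= V a 0 * (p1 - psi t 0) \/ 0 <= V a 0 * (psi t 0 - p2)).
  { destruct (Rle_lt_dec t (x - m)) as [h|h].
    - left; destruct h as [h|h]; [left; now apply hsgn|].
      rewrite h; unfold p1; lra.
    - right; destruct (Rle_lt_dec (x + m) t) as [h'|h'].
      + destruct h' as [h'|h']; [left; now apply hsgn|].
        rewrite <- h'; unfold p2; lra.
      + exfalso; apply ht; lra. }
  apply Rmult_le_reg_l with (1 := q4); rewrite Rmult_0_r.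
  set (P := psi t 0) in *; set (v := V a 0) in *.
  replace (v * v * ((P - p1) * (p2 - P))) with ((v * (P - p1)) * (v * (p2 - P))) by ring.
  destruct q.
  - replace ((v * (P - p1)) * (v * (p2 - P))) with
      (- ((v * (p1 - P)) * (v * (p2 - P)))) by ring.
    assert (0 <= (v * (p1 - P)) * (v * (p2 - P))); [|lra].
    apply Rmult_le_pos; lra.
  - replace ((v * (P - p1)) * (v * (p2 - P))) with
      (- ((v * (P - p1)) * (v * (P - p2)))) by ring.
    assert (0 <= (v * (P - p1)) * (v * (P - p2))); [|lra].
    apply Rmult_le_pos; lra. }
assert (h : V a 0 * M x * (V x 0 * (M x * B x 0)) = 0).
{ apply (RInt_nonneg_eq0 (fun t => V a 0 * M x * (V t 0 * (M t * B t 0))) a b hab);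
    [| | |assumption].
  - intros t; apply continuity_pt_scal; apply continuity_pt_mult;
      [apply cont_V|apply continuity_pt_mult; [apply cM|apply cB]].
  - intros t ht.
    replace (V a 0 * M x * (V t 0 * (M t * B t 0))) with
      ((V a 0 * V t 0) * (M x * M t * B t 0)) by ring.
    apply Rmult_le_pos; [left; apply V_same_sign|].
    destruct (Rlt_le_dec (x - m) t) as [h1|h1]; [destruct (Rlt_le_dec t (x + m)) as [h2|h2]|].
    + apply Rmult_le_pos; [|left; apply hin; lra].
      assert (hb : Rabs (M x * M t - M x * M x) < M x * M x).
      { apply (hdel t); change (Rabs (t - x) < del); apply Rabs_def1; lra. }
      apply Rabs_def2 in hb; lra.
    + rewrite hout by lra; lra.
    + rewrite hout by lra; lra.
  - rewrite (RInt_scal (V := R_CompleteNormedModule) _ a b (V a 0 * M x)).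
    + rewrite hI0; apply Rmult_0_r.
    + apply ex_RInt_cont; intros t; apply continuity_pt_mult;
        [apply cont_V|apply continuity_pt_mult; [apply cM|apply cB]]. }
assert (h1 : 0 < (V a 0 * V x 0) * (M x * M x * B x 0)).
{ apply Rmult_lt_0_compat; [apply V_same_sign|].
  apply Rmult_lt_0_compat; [assumption|]; apply hin; lra. }
apply (Rlt_irrefl 0); rewrite <- h at 2.
eapply Rlt_le_trans; [exact h1|right; ring].
Qed.

Lemma div_closed x y : a <= x <= b -> 0 <= y <= th0 ->
  rho x y * U1 x y + U x y + V2 x y = 0.
Proof.
apply (zero_closed a b 0 th0 (fun x y => rho x y * U1 x y + U x y + V2 x y) hab hth0).
- apply cont2_plus; [apply cont2_plus|]; [apply cont2_mult| |];
    [apply rho_C1|apply hU1|apply hU|apply hV2].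
- intros u v hu hv; rewrite rho_id by lra; now apply hdiv.
Qed.

Lemma fst_derivative_per g g1 g2 x : is_C1 a b 0 th0 g g1 g2 ->
  (forall t, a <= t <= b -> g t 0 = g t th0) -> a < x < b -> g1 x 0 = g1 x th0.
Proof.
intros hg hper hx.
assert (d0 := is_derive_fst_closed _ _ _ _ _ _ _ x 0 hth0 hg hx ltac:(lra)).
assert (d1 := is_derive_fst_closed _ _ _ _ _ _ _ x th0 hth0 hg hx ltac:(lra)).
apply is_derive_unique in d0; apply is_derive_unique in d1.
rewrite <- d0, <- d1; apply Derive_ext_loc.
apply (filter_imp (fun t => a < t < b)); [|now apply locally_between].
intros t ht; apply hper; lra.
Qed.

Lemma angular_derivatives_per x : a < x < b -> V2 x 0 = V2 x th0 /\ U2 x 0 = U2 x th0.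
Proof.
intros hx.
assert (eV1 := fst_derivative_per _ _ _ x hV hVper hx).
assert (eU1 := fst_derivative_per _ _ _ x hU hUper hx).
assert (eV := hVper x ltac:(lra)); assert (eU := hUper x ltac:(lra)).
assert (D0 := div_closed x 0 ltac:(lra) ltac:(lra)).
assert (D1 := div_closed x th0 ltac:(lra) ltac:(lra)).
assert (ew := vorticity_per x hx).
unfold w, Z in ew; rewrite !rho_id in * by lra.
rewrite eU1, eU in D0; rewrite eV1, eV in ew.
split; [lra|].
apply Rmult_eq_reg_r in ew; [lra|apply Rinv_neq_0_compat; lra].
Qed.

(** The slope of the stream lines in the coordinates (log r, theta). *)
Let sg (x y : R) : R := U x y / V x y.

(** The divergence of (r V)^2 grad sg in the coordinates (log r, theta), divided by
    r^2, equals - 2 r w U.  The left-hand side below is this quotient with the second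
    derivatives written out. *)
Lemma energy_identity x y : a < x < b -> 0 < y < th0 ->
  (U22 x y * V x y - U x y * V22 x y) + 3 * x * (U1 x y * V x y - U x y * V1 x y) +
  x * x * (U11 x y * V x y - U x y * V11 x y) = - (2 * (x * w x y) * U x y).
Proof.
intros hx hy.
assert (T := Z_transport x y hx hy).
destruct (div_derive x y hx hy) as [D1 D2].
assert (D := hdiv x y hx hy).
assert (e12 := V12_V21 x y hx hy); assert (f12 := U12_U21 x y hx hy).
replace (x * w x y) with (Z x y) by (unfold w; rewrite rho_id by lra; field; lra).
unfold Z, Z1, Z2 in *; rewrite rho_id in * by lra; rewrite e12, <- f12 in T.
match type of T with ?t = 0 => match type of D with ?d = 0 =>
match type of D1 with ?d1 = 0 => match type of D2 with ?d2 = 0 =>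
match goal with |- ?l = ?r =>
  assert (h : l - r = - t + V x y * d + x * V x y * d1 - U x y * d2) by ring
end end end end end.
rewrite T, D, D1, D2 in h; lra.
Qed.

Lemma no_radial_velocity k : (forall x y, 0 < k * V x y) ->
  (forall x y, a < x < b -> 0 < y < th0 -> k * w x y <= 0) ->
  forall x y, a <= x <= b -> 0 <= y <= th0 -> U x y = 0.
Proof.
intros hk hw; apply zero_closed; [assumption|assumption|apply hU|].
assert (hsg : is_C1 a b 0 th0 sg
  (fun x y => (U1 x y * V x y - U x y * V1 x y) / (V x y * V x y))
  (fun x y => (U2 x y * V x y - U x y * V2 x y) / (V x y * V x y)))
  by apply (C1_div _ _ _ _ _ _ _ _ _ _ hU hV hV0).
assert (hA := C1_mult _ _ _ _ _ _ _ _ _ _ rho_C1 (C1_mult _ _ _ _ _ _ _ _ _ _ hsg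
  (C1_minus _ _ _ _ _ _ _ _ _ _ (C1_mult _ _ _ _ _ _ _ _ _ _ hU2 hV)
    (C1_mult _ _ _ _ _ _ _ _ _ _ hU hV2)))).
assert (hB := C1_mult _ _ _ _ _ _ _ _ _ _ (C1_mult _ _ _ _ _ _ _ _ _ _ rho_C1
    (C1_mult _ _ _ _ _ _ _ _ _ _ rho_C1 rho_C1)) (C1_mult _ _ _ _ _ _ _ _ _ _ hsg
  (C1_minus _ _ _ _ _ _ _ _ _ _ (C1_mult _ _ _ _ _ _ _ _ _ _ hU1 hV)
    (C1_mult _ _ _ _ _ _ _ _ _ _ hU hV1)))).
assert (hflux := flux_zero a b 0 th0 _ _ _ _ _ _ hab hth0 hA hB); cbv beta in hflux.
(* The divergence of the energy flux as a sum of three nonnegative terms. *)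
assert (hid : forall x y, a < x < b -> 0 < y < th0 ->
  0 * (sg x y * (U2 x y * V x y - U x y * V2 x y)) +
  rho x y * ((U2 x y * V x y - U x y * V2 x y) / (V x y * V x y) *
      (U2 x y * V x y - U x y * V2 x y) +
    sg x y * (U22 x y * V x y + U2 x y * V2 x y - (U2 x y * V2 x y + U x y * V22 x y))) +
  ((1 * (rho x y * rho x y) + rho x y * (1 * rho x y + rho x y * 1)) *
    (sg x y * (U1 x y * V x y - U x y * V1 x y)) +
   rho x y * (rho x y * rho x y) *
    ((U1 x y * V x y - U x y * V1 x y) / (V x y * V x y) *
      (U1 x y * V x y - U x y * V1 x y) +
    sg x y * (U11 x y * V x y + U1 x y * V1 x y - (U1 x y * V1 x y + U x y * V11 x y)))) =
  x * ((U2 x y * V x y - U x y * V2 x y) / V x y) ^ 2 +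
  x * (x * ((U1 x y * V x y - U x y * V1 x y) / V x y)) ^ 2 +
  2 * x * x * (- (w x y * V x y)) * sg x y ^ 2).
{ intros x y hx hy; rewrite rho_id by lra.
  assert (E := energy_identity x y hx hy).
  assert (v0 := hV0 x y).
  match type of E with ?l = ?r => match goal with |- ?L = ?R =>
    assert (h : L - R = x * sg x y * (l - r)) by (unfold sg; field; assumption) end end.
  rewrite E, Rminus_eq_0, Rmult_0_r in h; lra. }
assert (hneg : forall x y, a < x < b -> 0 < y < th0 -> 0 <= - (w x y * V x y)).
{ intros x y hx hy.
  assert (q1 := hw x y hx hy); assert (q2 := hk x y).
  assert (q3 : k <> 0) by (intros e; rewrite e in q2; lra).
  assert (q4 : 0 < k * k) by now apply Rlt_0_sqr.
  apply Rmult_le_reg_l with (1 := q4); rewrite Rmult_0_r.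
  replace (k * k * - (w x y * V x y)) with (- (k * w x y) * (k * V x y)) by ring.
  apply Rmult_le_pos; lra. }
assert (hpos : forall x y, a < x < b -> 0 < y < th0 ->
  0 <= x * ((U2 x y * V x y - U x y * V2 x y) / V x y) ^ 2 /\
  0 <= x * (x * ((U1 x y * V x y - U x y * V1 x y) / V x y)) ^ 2 /\
  0 <= 2 * x * x * (- (w x y * V x y)) * sg x y ^ 2).
{ intros x y hx hy; split; [|split].
  - apply Rmult_le_pos; [lra|apply pow2_ge_0].
  - apply Rmult_le_pos; [lra|apply pow2_ge_0].
  - apply Rmult_le_pos; [|apply pow2_ge_0].
    apply Rmult_le_pos; [|now apply hneg].
    apply Rmult_le_pos; lra. }
assert (hp0 : forall x y, a < x < b -> 0 < y < th0 ->
  U1 x y * V x y - U x y * V1 x y = 0).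
{ intros x y hx hy.
  assert (h0 : x * (x * ((U1 x y * V x y - U x y * V1 x y) / V x y)) ^ 2 = 0).
  { assert (h := hid x y hx hy); rewrite hflux in h; [|clear h|clear h|clear h|assumption|assumption].
    - destruct (hpos x y hx hy); lra.
    - intros s t hs ht; rewrite hid by assumption; destruct (hpos s t hs ht); lra.
    - intros t ht; unfold sg; destruct (hwall t ltac:(lra)) as [-> ->].
      unfold Rdiv; split; ring.
    - intros s hs; destruct (angular_derivatives_per s hs) as [-> ->].
      unfold sg; rewrite (hVper s), (hUper s) by lra.
      rewrite !rho_id by lra; reflexivity. }
  assert (v0 := hV0 x y).
  apply Rmult_integral in h0; destruct h0 as [h0|h0]; [lra|].
  apply Rsqr_0_uniq in h0 || (rewrite <- Rsqr_pow2 in h0; apply Rsqr_0_uniq in h0).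
  apply Rmult_integral in h0; destruct h0 as [h0|h0]; [lra|].
  apply Rmult_integral in h0; destruct h0 as [h0|h0]; [assumption|].
  exfalso; revert h0; now apply Rinv_neq_0_compat. }
intros x y hx hy.
assert (e : sg x y = sg a y).
{ apply (derive_zero_const (fun t => sg t y) a x); [lra| |].
  - intros t; apply cont2_fst, hsg.
  - intros t ht; destruct (proj2 (proj2 (proj2 hsg)) t y ltac:(lra) hy) as [d _].
    rewrite hp0 in d by lra; unfold Rdiv in d; rewrite Rmult_0_l in d; exact d. }
unfold sg in e; destruct (hwall y ltac:(lra)) as [e0 _]; rewrite e0 in e.
unfold Rdiv in e; rewrite Rmult_0_l in e.
apply Rmult_integral in e; destruct e as [e|e]; [assumption|].
exfalso; revert e; apply Rinv_neq_0_compat, hV0.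
Qed.

Lemma no_angular_dependence :
  (forall x y, a <= x <= b -> 0 <= y <= th0 -> U x y = 0) ->
  forall x y, a <= x <= b -> 0 <= y <= th0 -> V x y = V x 0.
Proof.
intros h0 x y hx hy; apply Rminus_diag_uniq.
assert (hU10 : forall s t, a < s < b -> 0 < t < th0 -> U1 s t = 0).
{ intros s t hs ht; transitivity (Derive (fun r => U r t) s).
  - symmetry; now apply is_derive_unique, hU.
  - transitivity (Derive (fun _ => 0) s); [|apply Derive_const].
    apply Derive_ext_loc, (filter_imp (fun r => a < r < b)); [|now apply locally_between].
    intros r hr; apply h0; lra. }
assert (hV20 : forall s t, a <= s <= b -> 0 <= t <= th0 -> V2 s t = 0).
{ apply zero_closed; [assumption|assumption|apply hV2|].
  intros s t hs ht; rewrite <- (hdiv s t hs ht), hU10, h0 by lra; ring. }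
apply Rminus_diag_eq, (derive_zero_const (fun t => V x t) 0 y); [lra| |].
- intros t; apply cont2_snd, hV.
- intros t ht; rewrite <- (hV20 x t) by lra.
  apply (is_derive_snd_closed a b 0 th0 V V1 V2); try assumption; lra.
Qed.

(** [V + x V1 - U2] is r times the vorticity. *)
Lemma circular_of_vorticity_sign k e : (forall x y, 0 < k * V x y) -> 0 <= e <= th0 ->
  (forall x, a < x < b -> k * (V x e + x * V1 x e - U2 x e) <= 0) ->
  forall x y, a <= x <= b -> 0 <= y <= th0 -> U x y = 0 /\ V x y = V x 0.
Proof.
intros hk he hsgn.
assert (hw : forall x y, a < x < b -> 0 <= y <= th0 -> k * w x y <= 0).
{ apply (vorticity_sign k e hk he); intros x hx.
  unfold w, Z; rewrite rho_id by lra; unfold Rdiv; rewrite <- Rmult_assoc.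
  assert (h := hsgn x hx); assert (hi : 0 < / x) by (apply Rinv_0_lt_compat; lra).
  rewrite <- (Rmult_0_l (/ x)); apply Rmult_le_compat_r; lra. }
assert (h0 : forall x y, a <= x <= b -> 0 <= y <= th0 -> U x y = 0).
{ apply (no_radial_velocity k hk); intros x y hx hy; apply hw; lra. }
intros x y hx hy; split; [now apply h0|now apply no_angular_dependence].
Qed.

End Flow.

(** * The rigidity theorem *)

Lemma Ck2_clamp a b c d g : a <= b -> c <= d -> Ck_closed 2 a b c d g ->
  exists g1 g2 g11 g12 g21 g22,
    is_C1 a b c d (fun x y => g (clamp a b x) (clamp c d y)) g1 g2 /\
    is_C1 a b c d g1 g11 g12 /\ is_C1 a b c d g2 g21 g22.
Proof.
intros hab hcd (cg & g1 & g2 & dg & (cg1 & g11 & g12 & dg1 & (cg11 & _) & (cg12 & _)) &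
  (cg2 & g21 & g22 & dg2 & (cg21 & _) & (cg22 & _))).
exists (fun x y => g1 (clamp a b x) (clamp c d y)), (fun x y => g2 (clamp a b x) (clamp c d y)),
  (fun x y => g11 (clamp a b x) (clamp c d y)), (fun x y => g12 (clamp a b x) (clamp c d y)),
  (fun x y => g21 (clamp a b x) (clamp c d y)), (fun x y => g22 (clamp a b x) (clamp c d y)).
split; [|split]; apply C1_clamp; assumption.
Qed.

Lemma is_derive_Rpower x y : 0 < x ->
  is_derive (fun t => Rpower t y) x (y * Rpower x y / x).
Proof.
intros hx; apply is_derive_Reals.
replace (y * Rpower x y / x) with (y * Rpower x (y - 1)).
- now apply derivable_pt_lim_power.
- unfold Rminus; rewrite Rpower_plus, Rpower_Ropp, Rpower_1 by assumption.
  field; lra.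
Qed.

Lemma Rpower_pos x y : 0 < Rpower x y.
Proof. apply exp_pos. Qed.

Lemma is_derive_div_Rpower c y x : 0 < x ->
  is_derive (fun t => c / Rpower t y) x (- (y * (c / Rpower x y) / x)).
Proof.
intros hx.
assert (hK := Rpower_pos x y).
replace (- (y * (c / Rpower x y) / x)) with (c * (- y * Rpower x (- y) / x)).
- apply (is_derive_ext (fun t => c * Rpower t (- y))).
  + intros t; rewrite Rpower_Ropp; reflexivity.
  + apply @is_derive_scal; now apply is_derive_Rpower.
- rewrite Rpower_Ropp; field; lra.
Qed.

(** Integration of the pressure gradient of the circular flow, which is radial and
    equal to (c / r^alpha)^2 / r. *)
Lemma circular_pressure alpha th0 c u P : alpha <> 0 -> 0 < th0 ->
  (forall r th, open_rect 1 2 0 th0 (r, th) ->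
     u (polar r th) = polar_field (fun r _ => c / Rpower r alpha) (fun _ _ => 0) r th) ->
  stationary_Euler (Omega 1 2 th0) u P ->
  exists C, forall r th, open_rect 1 2 0 th0 (r, th) ->
    P (polar r th) = - (c ^ 2 / (2 * alpha * Rpower r (2 * alpha))) + C.
Proof.
intros halpha hth0 hu hE.
assert (h12 : 1 < 2) by lra.
assert (hd : forall r th, 1 < r < 2 -> 0 < th < th0 ->
  is_derive (fun t => P (polar t th)) r ((c / Rpower r alpha) ^ 2 / r) /\
  is_derive (fun t => P (polar r t)) th 0).
{ intros r th hr hth.
  assert (hr0 : 0 < r) by lra.
  assert (hK := Rpower_pos r alpha).
  destruct (Euler_polar 1 2 th0 u P _ _ Rle_0_1 hu hE r th _ 0 0 0 hr hth
    (is_derive_div_Rpower c alpha r hr0)) as (_ & d1 & d2);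
    try apply @is_derive_const.
  split.
  - match type of d1 with is_derive _ _ ?l =>
      replace ((c / Rpower r alpha) ^ 2 / r) with l; [exact d1|field; lra] end.
  - match type of d2 with is_derive _ _ ?l =>
      replace 0 with l; [exact d2|field; lra] end. }
set (F := fun r th => P (polar r th) + c ^ 2 / (2 * alpha) / Rpower r (2 * alpha)).
assert (hF : forall r th, 1 < r < 2 -> 0 < th < th0 ->
  is_derive (fun t => F t th) r 0 /\ is_derive (fun t => F r t) th 0).
{ intros r th hr hth; destruct (hd r th hr hth) as [d1 d2]; split.
  - assert (hr0 : 0 < r) by lra.
    assert (hK := Rpower_pos r alpha).
    assert (d3 := is_derive_plus _ _ _ _ _ d1
      (is_derive_div_Rpower (c ^ 2 / (2 * alpha)) (2 * alpha) r hr0)).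
    match type of d3 with is_derive _ _ ?l => replace 0 with l; [exact d3|] end.
    unfold plus; simpl.
    replace (2 * alpha) with (alpha + alpha) at 3 by ring.
    rewrite Rpower_plus; field; lra.
  - assert (d3 := is_derive_plus _ _ _ _ _ d2
      (is_derive_const (c ^ 2 / (2 * alpha) / Rpower r (2 * alpha)) th)).
    match type of d3 with is_derive _ _ ?l => replace 0 with l; [exact d3|] end.
    apply Rplus_0_l. }
assert (const1 : forall f p q, p < q -> (forall t : R, p < t < q -> is_derive f t 0) ->
  forall s t, p < s < q -> p < t < q -> f s = f t).
{ intros f p q hpq hf.
  assert (lt : forall s t, p < s < q -> p < t < q -> s < t -> f s = f t).
  { intros s t hs ht hst; apply (eq_is_derive f s t); [|assumption].
    intros z hz; apply hf; lra. }
  intros s t hs ht; destruct (Rtotal_order s t) as [h|[->|h]];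
    [now apply lt|reflexivity|symmetry; now apply lt]. }
exists (F (3 / 2) (th0 / 2)); intros r th [hr hth]; simpl in hr, hth.
assert (e : F r th = F (3 / 2) (th0 / 2)).
{ assert (h32 : 1 < 3 / 2 < 2) by lra.
  assert (ht2 : 0 < th0 / 2 < th0) by lra.
  transitivity (F (3 / 2) th).
  - exact (const1 (fun t => F t th) 1 2 h12 (fun t ht => proj1 (hF t th ht hth))
      r (3 / 2) hr h32).
  - exact (const1 (fun t => F (3 / 2) t) 0 th0 hth0
      (fun t ht => proj2 (hF (3 / 2) t h32 ht)) th (th0 / 2) hth ht2). }
rewrite <- e; unfold F; assert (hK := Rpower_pos r (2 * alpha)); field; lra.
Qed.

Theorem theorem3 (alpha theta0 : R) (halpha : 1 <= alpha)
    (htheta0 : 0 < theta0 <= 2 * PI)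
    (u : R * R -> R * R) (P : R * R -> R) (ut ur : R -> R -> R)
    (hu : forall r theta, open_rect 1 2 0 theta0 (r, theta) ->
       u (polar r theta) = polar_field ut ur r theta)
    (hut : Ck_closed 2 1 2 0 theta0 ut)
    (hur : Ck_closed 2 1 2 0 theta0 ur)
    (hEuler : stationary_Euler (Omega 1 2 theta0) u P)
    (hpos : forall r theta, closed_rect 1 2 0 theta0 (r, theta) ->
       0 < Rabs (ut r theta))
    (c1 c2 : R)
    (hc1 : forall r, 1 <= r <= 2 -> ut r 0 = c1 / Rpower r alpha)
    (hc2 : forall r, 1 <= r <= 2 -> ut r theta0 = c2 / Rpower r alpha)
    (hper : forall r, 1 <= r <= 2 -> ur r 0 = ur r theta0)
    (hwall : forall theta, 0 <= theta <= theta0 ->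
       ur 1 theta = 0 /\ ur 2 theta = 0) :
  exists c : R, c1 = c /\ c2 = c /\ c <> 0 /\
    (((forall r, 1 <= r <= 2 -> exists l,
         is_derive_seg 0 theta0 (fun t => Rpower r alpha * ur r t) 0 l /\
         / c * l >= 1 - alpha) \/
      (forall r, 1 <= r <= 2 -> exists l,
         is_derive_seg 0 theta0 (fun t => Rpower r alpha * ur r t) theta0 l /\
         / c * l >= 1 - alpha)) ->
     homogeneous_field alpha 1 2 theta0 ut ur /\
     homogeneous_pressure_upto_const alpha 1 2 theta0 P /\
     (forall r theta, closed_rect 1 2 0 theta0 (r, theta) ->
        polar_field ut ur r theta = scal (c / Rpower r alpha) (e_theta theta)) /\
     exists C : R, forall r theta, open_rect 1 2 0 theta0 (r, theta) ->
       P (polar r theta) = - (c ^ 2 / (2 * alpha * Rpower r (2 * alpha))) + C).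
Proof.
assert (h12 : 1 < 2) by lra.
assert (h01 : 0 < 1) by lra.
assert (hth : 0 < theta0) by lra.
destruct (Ck2_clamp 1 2 0 theta0 ut ltac:(lra) ltac:(lra) hut)
  as (V1 & V2 & V11 & V12 & V21 & V22 & hV & hV1 & hV2).
destruct (Ck2_clamp 1 2 0 theta0 ur ltac:(lra) ltac:(lra) hur)
  as (U1 & U2 & U11 & U12 & U21 & U22 & hU & hU1 & hU2).
set (V := fun x y => ut (clamp 1 2 x) (clamp 0 theta0 y)) in *.
set (U := fun x y => ur (clamp 1 2 x) (clamp 0 theta0 y)) in *.
assert (eV : forall x y, 1 <= x <= 2 -> 0 <= y <= theta0 -> V x y = ut x y).
{ intros x y hx hy; unfold V; now rewrite !clamp_id. }
assert (eU : forall x y, 1 <= x <= 2 -> 0 <= y <= theta0 -> U x y = ur x y).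
{ intros x y hx hy; unfold U; now rewrite !clamp_id. }
assert (hV0 : forall x y, V x y <> 0).
{ intros x y e; assert (h := hpos (clamp 1 2 x) (clamp 0 theta0 y)).
  unfold V in e; rewrite e, Rabs_R0 in h; apply (Rlt_irrefl 0), h.
  split; apply clamp_in; lra. }
assert (huV : forall r th, open_rect 1 2 0 theta0 (r, th) ->
  u (polar r th) = polar_field V U r th).
{ intros r th [hr ht]; simpl in hr, ht; rewrite hu by (split; assumption).
  unfold polar_field; rewrite eV, eU by lra; reflexivity. }
assert (hEp := fun x y (hx : 1 < x < 2) (hy : 0 < y < theta0) =>
  Euler_polar 1 2 theta0 u P V U Rle_0_1 huV hEuler x y _ _ _ _ hx hy
    (proj1 (proj2 (proj2 (proj2 hV)) x y hx hy))
    (proj2 (proj2 (proj2 (proj2 hV)) x y hx hy))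
    (proj1 (proj2 (proj2 (proj2 hU)) x y hx hy))
    (proj2 (proj2 (proj2 (proj2 hU)) x y hx hy))).
assert (hdiv : forall x y, 1 < x < 2 -> 0 < y < theta0 ->
  x * U1 x y + U x y + V2 x y = 0).
{ intros x y hx hy; now apply hEp. }
set (p := fun x y => P (polar x y)).
assert (hp : forall x y, 1 < x < 2 -> 0 < y < theta0 ->
  is_derive (fun t => p t y) x ((V x y * V x y - V x y * U2 x y) / x - U x y * U1 x y) /\
  is_derive (fun t => p x t) y (- (x * (U x y * V1 x y) + V x y * V2 x y + U x y * V x y))).
{ intros x y hx hy; now apply hEp. }
assert (hwallU : forall y, 0 <= y <= theta0 -> U 1 y = 0 /\ U 2 y = 0).
{ intros y hy; rewrite !eU by lra; now apply hwall. }
assert (hV10 : forall x, 1 <= x <= 2 -> V x 0 = c1 / Rpower x alpha).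
{ intros x hx; rewrite eV by lra; now apply hc1. }
assert (hV20 : forall x, 1 <= x <= 2 -> V x theta0 = c2 / Rpower x alpha).
{ intros x hx; rewrite eV by lra; now apply hc2. }
assert (hc : c1 = c2).
{ assert (hI := transported_flux 1 2 theta0 h12 V V1 V2 U U1 U2 hV hU hdiv hwallU
    _ _ _ theta0 (transported_const 1 2 theta0 V U 1) ltac:(lra)).
  cbv beta in hI.
  assert (cV : forall y, continuity (fun x => V x y * 1)).
  { intros y x; apply continuity_pt_mult; [apply cont2_fst, hV|].
    now apply continuity_pt_const; intros ? ?. }
  assert (h : (c1 - c2) * (V (3 / 2) 0 * 1 - V (3 / 2) theta0 * 1) = 0).
  { apply (RInt_nonneg_eq0 (fun x => (c1 - c2) * (V x 0 * 1 - V x theta0 * 1)) 1 2);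
      [lra| | | |lra].
    - intros x; apply continuity_pt_scal, continuity_pt_minus; apply cV.
    - intros x hx; rewrite hV10, hV20 by lra.
      assert (hK := Rpower_pos x alpha).
      replace ((c1 - c2) * (c1 / Rpower x alpha * 1 - c2 / Rpower x alpha * 1)) with
        ((c1 - c2) ^ 2 / Rpower x alpha) by (field; lra).
      apply Rmult_le_pos; [apply pow2_ge_0|left; now apply Rinv_0_lt_compat].
    - rewrite (RInt_scal (V := R_CompleteNormedModule) _ 1 2 (c1 - c2)).
      + rewrite (RInt_minus (V := R_CompleteNormedModule) (fun x => V x 0 * 1)
          (fun x => V x theta0 * 1)) by now apply ex_RInt_cont.
        rewrite hI, minus_eq_zero; apply Rmult_0_r.
      + apply ex_RInt_cont; intros x; apply continuity_pt_minus; apply cV. }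
  rewrite hV10, hV20 in h by lra.
  assert (hK := Rpower_pos (3 / 2) alpha).
  assert (h' : (c1 - c2) * (c1 - c2) = 0).
  { apply Rmult_eq_reg_r with (/ Rpower (3 / 2) alpha); [|apply Rinv_neq_0_compat; lra].
    rewrite Rmult_0_l, <- h; field; lra. }
  apply Rmult_integral in h'; lra. }
subst c2; exists c1; split; [reflexivity|split; [reflexivity|]].
assert (hc0 : c1 <> 0).
{ intros e; apply (hV0 1 0); rewrite hV10, e by lra; apply Rdiv_0_l. }
split; [assumption|]; intros hsgn.
assert (hVper : forall x, 1 <= x <= 2 -> V x 0 = V x theta0).
{ intros x hx; now rewrite hV10, hV20. }
assert (hUper : forall x, 1 <= x <= 2 -> U x 0 = U x theta0).
{ intros x hx; rewrite !eU by lra; now apply hper. }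
set (k := V 1 0).
assert (hk : forall x y, 0 < k * V x y).
{ intros x y; apply cont2_same_sign; [apply hV|exact hV0]. }
assert (hk1 : k = c1 / Rpower 1 alpha) by (apply hV10; lra).
(* From here on [e] is the ray on which the derivative condition holds. *)
assert (hsgn' : exists e, (e = 0 \/ e = theta0) /\ forall r, 1 <= r <= 2 -> exists l,
  is_derive_seg 0 theta0 (fun t => Rpower r alpha * ur r t) e l /\ / c1 * l >= 1 - alpha).
{ destruct hsgn as [h|h]; [exists 0|exists theta0]; split; auto. }
destruct hsgn' as (e & he & hsgn').
assert (he' : 0 <= e <= theta0) by (destruct he; lra).
assert (hVe : forall x, 1 <= x <= 2 -> V x e = c1 / Rpower x alpha).
{ intros x hx; destruct he as [-> | ->]; auto. }
(* On the ray, V = c / r^alpha gives V + r V1 - U2 = (c / r^alpha) ((1 - alpha) - l / c),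
   so the condition on [l] says that the product of [c] and the vorticity is at most 0. *)
assert (hz : forall x, 1 < x < 2 -> k * (V x e + x * V1 x e - U2 x e) <= 0).
{ intros x hx; destruct (hsgn' x ltac:(lra)) as (l & hl & hle).
  assert (hK := Rpower_pos x alpha); assert (hK1 := Rpower_pos 1 alpha).
  assert (el : l = 0 * U x e + Rpower x alpha * U2 x e).
  { apply (is_derive_seg_unique 1 2 0 theta0 _ _ _ x e l h12 hth
      (C1_mult _ _ _ _ _ _ _ _ _ _ (C1_const 1 2 0 theta0 (Rpower x alpha)) hU));
      [lra|lra|].
    unfold is_derive_seg; rewrite eU by lra; revert hl; unfold is_derive_seg.
    apply filterlim_within_ext; intros t ht; now rewrite eU by lra. }
  assert (eV1 : V1 x e = - (alpha * (c1 / Rpower x alpha) / x)).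
  { transitivity (Derive (fun t => V t e) x).
    - symmetry; apply is_derive_unique.
      now apply (is_derive_fst_closed 1 2 0 theta0 V V1 V2).
    - transitivity (Derive (fun t => c1 / Rpower t alpha) x).
      + apply Derive_ext_loc, (filter_imp (fun t => 1 < t < 2));
          [|now apply locally_between].
        intros t ht; apply hVe; lra.
      + apply is_derive_unique, is_derive_div_Rpower; lra. }
  rewrite hVe, eV1 by lra.
  replace (U2 x e) with (l / Rpower x alpha) by (rewrite el; field; lra).
  rewrite hk1.
  replace (c1 / Rpower 1 alpha * (c1 / Rpower x alpha +
    x * - (alpha * (c1 / Rpower x alpha) / x) - l / Rpower x alpha)) with
    ((c1 * c1 * / Rpower 1 alpha * / Rpower x alpha) * ((1 - alpha) - / c1 * l))
    by (field; repeat split; lra).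
  rewrite <- (Rmult_0_r (c1 * c1 * / Rpower 1 alpha * / Rpower x alpha)).
  apply Rmult_le_compat_l; [|lra].
  apply Rinv_0_lt_compat in hK; apply Rinv_0_lt_compat in hK1.
  apply Rmult_le_pos; [apply Rmult_le_pos|]; try lra.
  apply Rle_0_sqr. }
assert (hcirc := circular_of_vorticity_sign 1 2 theta0 h01 h12 hth
  V V1 V2 V11 V12 V21 V22 U U1 U2 U11 U12 U21 U22 p hV hV1 hV2 hU hU1 hU2
  hdiv hp hV0 hwallU hVper hUper k e hk he' hz).
assert (hut' : forall r th, closed_rect 1 2 0 theta0 (r, th) ->
  ut r th = c1 / Rpower r alpha /\ ur r th = 0).
{ intros r th [hr ht]; simpl in hr, ht; destruct (hcirc r th hr ht) as [h1 h2].
  rewrite <- eV, <- eU, h2, hV10 by lra; auto. }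
assert (hfield : forall r th, closed_rect 1 2 0 theta0 (r, th) ->
  polar_field ut ur r th = scal (c1 / Rpower r alpha) (e_theta th)).
{ intros r th h; destruct (hut' r th h) as [e1 e2]; unfold polar_field; rewrite e1, e2.
  now rewrite (scal_zero_l (e_r th) : scal 0 (e_r th) = zero), plus_zero_r. }
destruct (circular_pressure alpha theta0 c1 u P) as [C hC]; try assumption; try lra.
{ intros r th h; rewrite hu by assumption; unfold polar_field.
  destruct (hut' r th) as [-> ->]; [|reflexivity].
  destruct h; split; simpl in *; lra. }
split; [|split; [|split]].
- exists (fun _ => c1), (fun _ => 0); intros r th h; rewrite hfield by assumption.
  unfold Rdiv at 3; rewrite Rmult_0_l.
  now rewrite (scal_zero_l (e_r th) : scal 0 (e_r th) = zero), plus_zero_r.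
- exists C, (fun _ => - (c1 ^ 2 / (2 * alpha))); intros r th h; rewrite hC by assumption.
  assert (hK := Rpower_pos r (2 * alpha)); rewrite Rpower_Ropp; field; lra.
- exact hfield.
- exists C; exact hC.
Qed.
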